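(* Let $X$ be a locally connected compact metrizable group and $T$ a minimal rotation of $X$. Let $u\mapsto A_u$ be a continuous action of $\mathbb R$ on $\mathbb R^d$ by linear automorphisms such that for every $u\neq0$ the map $A_u$ has no eigenvalue equal to $1$, and let $G=\mathbb R^d\rtimes\mathbb R$ with multiplication $(v_1,u_1)\cdot(v_2,u_2)=(v_1+A_{u_1}(v_2),u_1+u_2)$. If $f:X\to G$ is continuous and its cocycle is recurrent, then $f$ is regular, i.e. some $T_f$-orbit closure in $X\times G$ projects onto $X$.
   Context: Cocycle: $f(n,x)=f(T^{n-1}x)\cdots f(x)$ ($n\ge1$), $f(0,x)=e$, $f(n,x)=f(-n,T^nx)^{-1}$ ($n<0$); $T_f^n(x,g)=(T^nx,f(n,x)g)$ on $X\times G$. Recurrent: for every open neighbourhood $V$ of $e$ and nonempty open $\mathcal U\subseteq X$ there is $n\ne0$ with $\mathcal U\cap T^{-n}\mathcal U\cap\{x:f(n,x)\in V\}\ne\varnothing$. A minimal rotation is $Tx=ax$ for a fixed $a\in X$ with all orbits dense. *)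

(* Defs.v *)
From HB Require Import structures.
From mathcomp Require Import all_boot all_order all_algebra.
From mathcomp Require Import all_classical all_reals all_analysis.
Set Implicit Arguments. Unset Strict Implicit. Unset Printing Implicit Defensive.
Import Order.TTheory GRing.Theory Num.Theory.
Import numFieldTopology.Exports numFieldNormedType.Exports.
Local Open Scope classical_set_scope.
Local Open Scope ring_scope.

Definition is_group (X : Type) (mul : X -> X -> X) (inv : X -> X) (e : X) :=
  [/\ (forall x y z, mul x (mul y z) = mul (mul x y) z),
      (forall x, mul e x = x), (forall x, mul x e = x),
      (forall x, mul (inv x) x = e) & (forall x, mul x (inv x) = e)].

Definition topological_group (X : topologicalType)
  (mul : X -> X -> X) (inv : X -> X) (e : X) :=
  [/\ is_group mul inv e,
      continuous (fun p : X * X => mul p.1 p.2) & continuous inv].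

Definition locally_connected (X : topologicalType) :=
  forall (x : X) (U : set X), nbhs x U ->
    exists V : set X, [/\ open V, V x, connected V & V `<=` U].

Definition gpowz (X : Type) (mul : X -> X -> X) (inv : X -> X) (e : X)
  (a : X) (n : int) : X :=
  match n with
  | Posz k => iter k (mul a) e
  | Negz k => inv (iter k.+1 (mul a) e)
  end.

Definition rotZ (X : Type) (mul : X -> X -> X) (inv : X -> X) (e : X)
  (a : X) (n : int) (x : X) : X := mul (gpowz mul inv e a n) x.

Definition minimal_rotation (X : topologicalType)
  (mul : X -> X -> X) (inv : X -> X) (e : X) (a : X) :=
  forall x : X, closure [set rotZ mul inv e a n x | n in [set: int]] = [set: X].

(* G given by mulG, invG, eG; Tz n = T^n (n : int); f : X -> G.
   f(k,x) = f(T^(k-1) x) ... f(x) for k >= 1, f(0,x) = e,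
   f(n,x) = f(-n, T^n x)^-1 for n < 0. *)
Fixpoint cocycle_nat (X G : Type) (mulG : G -> G -> G) (eG : G)
  (Tz : int -> X -> X) (f : X -> G) (k : nat) (x : X) : G :=
  match k with
  | 0 => eG
  | k'.+1 => mulG (f (Tz (Posz k') x)) (cocycle_nat mulG eG Tz f k' x)
  end.

Definition cocycle (X G : Type) (mulG : G -> G -> G) (invG : G -> G) (eG : G)
  (Tz : int -> X -> X) (f : X -> G) (n : int) (x : X) : G :=
  match n with
  | Posz k => cocycle_nat mulG eG Tz f k x
  | Negz k => invG (cocycle_nat mulG eG Tz f k.+1 (Tz n x))
  end.

Definition recurrent (X G : topologicalType) (mulG : G -> G -> G) (invG : G -> G)
  (eG : G) (Tz : int -> X -> X) (f : X -> G) :=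
  forall (V : set G) (U : set X), open V -> V eG -> open U -> U !=set0 ->
    exists n : int, n != 0 /\
      exists x : X, [/\ U x, U (Tz n x) & V (cocycle mulG invG eG Tz f n x)].

(* regularity: some T_f-orbit closure in X * G projects onto X,
   where T_f^n (x, g) = (T^n x, f(n,x) g) *)
Definition regular (X G : topologicalType) (mulG : G -> G -> G) (invG : G -> G)
  (eG : G) (Tz : int -> X -> X) (f : X -> G) :=
  exists (x0 : X) (g0 : G),
    fst @` closure [set (Tz n x0, mulG (cocycle mulG invG eG Tz f n x0) g0)
                   | n in [set: int]] = [set: X].

Definition sdp_mul (R : realType) (d : nat) (A : R -> 'M[R]_d)
  (p q : 'cV[R]_d * R) : 'cV[R]_d * R :=
  (p.1 + A p.2 *m q.1, p.2 + q.2).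
Definition sdp_inv (R : realType) (d : nat) (A : R -> 'M[R]_d)
  (p : 'cV[R]_d * R) : 'cV[R]_d * R :=
  (- (A (- p.2) *m p.1), - p.2).
Definition sdp_one (R : realType) (d : nat) : 'cV[R]_d * R := (0, 0).

(* Main.v *)
Require Import Defs.
From HB Require Import structures.
From mathcomp Require Import all_boot all_order all_algebra.
From mathcomp Require Import all_classical all_reals all_analysis.
From mathcomp Require Import zify ring lra.
Import Order.TTheory GRing.Theory Num.Theory.
Import numFieldTopology.Exports numFieldNormedType.Exports.
Local Open Scope classical_set_scope.
Local Open Scope ring_scope.
Set Implicit Arguments. Unset Strict Implicit. Unset Printing Implicit Defensive.

(* Write [D x] ([ess_at]) for the set of limits of [f(n, y)] as [y -> x] and
   [T^n -> id], and [c] for the [R]-component of the cocycle.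

   Gap lemma ([gap_syndetic]): suppose that near some point a size function on [G]
   takes no value in [(r, r']] on [f(n, y)] when [T^n] is close to [id].  As [X] is
   locally connected, the times [n] with [T^n] close to [id] and [f(n, .)] of size
   at most [r] on a fixed open set then behave like a local group; recurrence and
   total boundedness of [X] make them syndetic, so the cocycle is bounded.

   For abelian cocycles this says that, modulo the largest linear subspace of
   essential values, an [R^d]-valued recurrent cocycle is bounded.  Hence either
   [c] is bounded, so a coboundary, and [f] is cohomologous to an [R^d]-valued
   cocycle, or every real number is an essential value of [c].

   In the latter case let [x0] be a generic point.  The translations in [D x0] form
   a closed subgroup of [R^d] stable under the flow [A]; it is a subspace [ker P]
   because [A_u] has no eigenvalue [1].  The gap lemma modulo [ker P] gives small
   elements of [D x0] that are not translations.  They have fixed points in [R^d],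
   and if these were unbounded modulo [ker P] then suitable powers would converge
   to a translation outside [ker P].  So for some [p] the group [D x0] contains all
   the [((1 - A_s) p, s)], and the same argument bounds [f(n, x0) p] modulo [ker P]
   when [T^n x0] is near [x0].  Multiplying [f(n, x0)] by elements of [D x0] thus
   brings it back to a compact set. *)

(** * Compactness and Baire category *)

Section Topology.
Variable R : realType.

(* A compactness principle replacing extraction of convergent subsequences. *)
Lemma compact_limit (T : topologicalType) (K : set T) (P : R -> set T) :
  compact K ->
  (forall e1 e2, e1 <= e2 -> P e1 `<=` P e2) ->
  (forall e, 0 < e -> exists2 t, K t & P e t) ->
  exists2 t, K t & forall V e, nbhs t V -> 0 < e -> exists2 t', V t' & P e t'.
Proof.
move=> cK Pmono Pex.
pose B := fun e => K `&` P e.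
have FF : ProperFilter (filter_from [set e : R | 0 < e] B).
  apply: filter_from_proper; last first.
    by move=> e e0; have [t Kt Pt] := Pex e e0; exists t.
  apply: filter_from_filter; first by exists 1 => /=.
  move=> e1 e2 /= e10 e20; exists (Num.min e1 e2); first by rewrite /= lt_min e10.
  by move=> t [Kt Pt]; split; split=> //; apply: Pmono Pt; rewrite ge_min lexx ?orbT.
have [|t [Kt cl]] := cK _ FF; first by exists 1 => //= t [].
exists t => // V e Vt e0.
have [|t' [[_ Pt'] Vt']] := cl (B e) V _ Vt; first by exists e.
by exists t'.
Qed.

(** Choose nonempty open sets [W n] with the closure of [W n.+1] inside both [W n] and [O n].
    Compactness, in place of completeness, yields a point lying in all these closures. *)
Lemma compact_baire (X : pseudoMetricType R) (O : nat -> set X) (U : set X) :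
  compact [set: X] -> open U -> U !=set0 ->
  (forall i, open (O i)) ->
  (forall i V, open V -> V !=set0 -> (V `&` O i) !=set0) ->
  exists2 x, U x & forall i, O i x.
Proof.
move=> cX oU U0 oO dO.
pose good (V : set X) := open V /\ V !=set0.
have step i (V : set X) : good V -> exists W, good W /\ closure W `<=` V `&` O i.
  move=> [oV V0]; have [x [Vx Ox]] := dO i V oV V0.
  have /nbhs_ballP[e /= e0 se] : nbhs x (V `&` O i).
    by apply: open_nbhs_nbhs; split=> //; exact: openI.
  exists (ball x (e / 2))°; split.
    by split; [exact: open_interior | exists x; apply: nbhsx_ballx; rewrite divr_gt0].
  move=> y /(_ (ball y (e / 2)) _)[]; first by apply: nbhsx_ballx; rewrite divr_gt0.
  move=> z [/interior_subset xz yz]; apply: se.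
  by apply: ball_split xz _; exact: ball_sym.
have /choice[g gP] : forall iV : nat * set X, exists W,
    good iV.2 -> good W /\ closure W `<=` iV.2 `&` O iV.1.
  move=> [i V]; have [gV|] := pselect (good V); last by exists V.
  by have [W ?] := step i V gV; exists W.
pose W := fix W n := if n is n'.+1 then g (n', W n') else U.
have gW n : good (W n).
  by elim: n => [//|n IH] /=; case: (gP (n, W n) IH).
have sW n : closure (W n.+1) `<=` W n `&` O n by case: (gP (n, W n) (gW n)).
have mW n k : W (n + k)%N `<=` W n.
  elim: k => [|k IH]; first by rewrite addn0.
  rewrite addnS => t Wt; apply: IH.
  by have [] := @sW _ t (subset_closure Wt).
have FF : ProperFilter (filter_from [set: nat] W).
  apply: filter_from_proper; last by move=> n _; case: (gW n).
  apply: filter_from_filter; first by exists 0%N.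
  move=> m n _ _; exists (m + n)%N => // t Wt.
  by split; [exact: mW Wt | rewrite addnC in Wt; exact: mW Wt].
have [|x [_ cl]] := cX _ FF; first by exists 0%N.
have clx n : closure (W n) x.
  by move=> B Bx; apply: cl => //; exists n.
exists x; first by have [] := @sW 0%N _ (clx 1%N).
by move=> i; have [] := @sW i _ (clx i.+1).
Qed.

End Topology.

(** * Cocycles over minimal equicontinuous actions *)

Section Dynamics.
Variables (R : realType) (X : pseudoMetricType R) (Tz : int -> X -> X).

Definition near_id (dl : R) (n : int) := forall x, ball x dl (Tz n x).

(** What is kept of a minimal rotation. The field [me_near] is its rigidity: a time that moves one
    point by little moves every point by little. *)
Record minimal_equicontinuous : Prop := MinimalEquicontinuous {
  me_compact : compact [set: X];
  me_0 : forall x, Tz 0 x = x;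
  me_add : forall n m x, Tz (n + m) x = Tz n (Tz m x);
  me_continuous : forall n, continuous (Tz n);
  me_dense : forall x (U : set X), open U -> U !=set0 -> exists n, U (Tz n x);
  me_near : forall dl : R, 0 < dl ->
    exists2 eta : R, 0 < eta & forall n x, ball x eta (Tz n x) -> near_id dl n }.

Hypothesis me : minimal_equicontinuous.

Lemma near_id0 dl : 0 < dl -> near_id dl 0.
Proof. by move=> dl0 x; rewrite (me_0 me); exact: ballxx. Qed.

Lemma near_idN dl n : near_id dl n -> near_id dl (- n).
Proof.
move=> nn x; apply: ball_sym; have := nn (Tz (- n) x).
by rewrite -(me_add me) subrr (me_0 me).
Qed.

Lemma near_idD d1 d2 n m : near_id d1 n -> near_id d2 m -> near_id (d1 + d2) (n + m).
Proof.
move=> nn nm x; rewrite (me_add me) addrC.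
by apply: ball_triangle (nm x) (nn _).
Qed.

Lemma near_id_le d1 d2 n : d1 <= d2 -> near_id d1 n -> near_id d2 n.
Proof. by move=> d12 nn x; exact: le_ball d12 _ (nn x). Qed.

(** Cover [X] by finitely many balls of radius [eta / 2] and keep one time of [N] for each ball that
    some [Tz n x0] with [N n] visits. The difference of two times visiting the same ball moves an
    orbit point by less than [eta], so [me_near] applies. *)
Lemma near_id_finite (x0 : X) (N : set int) (dl : R) : 0 < dl ->
  exists s : seq int, {in s, forall m, N m} /\
    forall n, N n -> exists2 m, m \in s & near_id dl (n - m).
Proof.
move=> dl0; have [eta eta0 nearE] := me_near me dl0.
have eta20 : 0 < eta / 2 by rewrite divr_gt0.
have fin (t : seq X) : exists s : seq int, {in s, forall m, N m} /\
    forall n, N n -> (exists2 x, x \in t & ball x (eta / 2) (Tz n x0)) ->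
      exists2 m, m \in s & near_id dl (n - m).
  elim: t => [|x t [s [sN IH]]]; first by exists [::]; split=> // n _ [].
  have [[m Nm xm]|nm] := pselect (exists2 m, N m & ball x (eta / 2) (Tz m x0)).
    exists (m :: s); split.
      by move=> k; rewrite inE => /predU1P[->//|]; exact: sN.
    move=> n Nn [y]; rewrite inE => /predU1P[->|yt] yn.
      exists m; rewrite ?inE ?eqxx//; apply: (nearE _ (Tz m x0)).
      rewrite -(me_add me) subrK.
      by apply: ball_split yn; exact: ball_sym.
    have [|k ks nk] := IH _ Nn; first by exists y.
    by exists k; rewrite // inE ks orbT.
  exists s; split=> // n Nn [y]; rewrite inE => /predU1P[->|yt] yn.
    by exfalso; apply: nm; exists n.
  by apply: IH => //; exists y.
have [t tcov] : exists t : seq X, forall y, exists2 x, x \in t & ball x (eta / 2) y.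
  have /compact_near_coveringP cov := me_compact me.
  (* The filter of all sequences that contain a given finite one: covering compactness along it
     produces a single finite net. *)
  pose F := filter_from [set: seq X] (fun s => [set t : seq X | {subset s <= t}]).
  have FF : Filter F.
    apply: filter_from_filter; first by exists [::].
    move=> s1 s2 _ _; exists (s1 ++ s2) => // t /= st.
    by split=> x xs; apply: st; rewrite mem_cat xs ?orbT.
  have [|s _ sP] := cov _ F (fun t y => exists2 x, x \in t & ball x (eta / 2) y) FF.
    move=> x _; exists ((ball x (eta / 2)), [set t : seq X | {subset [:: x] <= t}]).
      by split; [exact: nbhsx_ballx | exists [:: x]].
    by move=> [y t] /= [xy xt]; exists x => //; apply: xt; rewrite inE.
  by exists s => y; apply: sP.
have [s [sN sP]] := fin t.
by exists s; split=> // n Nn; apply: sP.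
Qed.

Lemma near_id_into (x : X) (U : set X) : nbhs x U ->
  exists2 dl : R, 0 < dl & forall n, near_id dl n -> U (Tz n x).
Proof.
move=> /nbhs_ballP[dl /= dl0 sU]; exists dl => // n nn; exact/sU.
Qed.

Lemma near_id_nbhs (x : X) (U : set X) : nbhs x U ->
  exists W, [/\ open W, W x, W `<=` U &
    exists2 dl : R, 0 < dl & forall n y, near_id dl n -> W y -> U (Tz n y)].
Proof.
move=> /nbhs_ballP[dl /= dl0 sU]; exists (ball x (dl / 2))°.
have dl20 : 0 < dl / 2 by rewrite divr_gt0.
split; [exact: open_interior|exact: nbhsx_ballx| |].
  move=> y /interior_subset xy; apply: sU; apply: le_ball xy.
  by rewrite ler_pdivrMr// ler_peMr ?ltW// ltrDl.
exists (dl / 2) => // n y nn /interior_subset xy.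
by apply: sU; apply: ball_split xy _; apply/ball_sym/ball_sym.
Qed.

End Dynamics.

(** * Essential values of a cocycle *)

Section Cocycles.
Variables (R : realType) (X : pseudoMetricType R) (Tz : int -> X -> X).
Variables (G : topologicalType) (mul : G -> G -> G) (inv : G -> G) (e : G).
Variable F : int -> X -> G.

Record continuous_cocycle : Prop := ContinuousCocycle {
  cc_continuous : forall n, continuous (F n);
  cc_add : forall n m x, F (n + m) x = mul (F n (Tz m x)) (F m x) }.

Definition recurrent_cocycle := forall (V : set G) (U : set X),
  open V -> V e -> open U -> U !=set0 ->
  exists n : int, n != 0 /\ exists x, [/\ U x, U (Tz n x) & V (F n x)].

(** Essential values localised at [x]. Here [y] varies near [x], which makes the relation closed in
    the pair of point and value ([ess_at_limit]). In [orbit_ess_at] the point is [x] itself, as is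
    needed to reach points of the orbit closure of [x]. *)
Definition ess_at (x : X) : set G := [set g | forall U V (dl : R),
  nbhs x U -> nbhs g V -> 0 < dl ->
  exists n y, [/\ near_id Tz dl n, U y & V (F n y)]].

Definition ess : set G := [set g | forall x, ess_at x g].

Definition orbit_ess_at (x : X) : set G := [set g | forall V (dl : R),
  nbhs g V -> 0 < dl -> exists n, near_id Tz dl n /\ V (F n x)].

Hypothesis me : minimal_equicontinuous Tz.
Hypothesis tgG : topological_group mul inv e.
Hypothesis cc : continuous_cocycle.

Let gG : is_group mul inv e. Proof. by case: tgG. Qed.
Let mulA x y z : mul x (mul y z) = mul (mul x y) z. Proof. by case: gG. Qed.
Let mul1 x : mul e x = x. Proof. by case: gG. Qed.
Let mulx1 x : mul x e = x. Proof. by case: gG. Qed.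
Let mulV x : mul (inv x) x = e. Proof. by case: gG. Qed.
Let mulxV x : mul x (inv x) = e. Proof. by case: gG. Qed.
Let Fadd := cc_add cc.
Let Tadd := me_add me.

Let mul_nbhs g h V : nbhs (mul g h) V ->
  exists V1 V2, [/\ nbhs g V1, nbhs h V2 & forall g' h', V1 g' -> V2 h' -> V (mul g' h')].
Proof.
move=> Vgh; case: tgG => _ cM _.
have [[V1 V2] [/= V1g V2h] sV] := cM (g, h) _ Vgh.
by exists V1, V2; split=> // g' h' V1g' V2h'; apply: (sV (g', h')).
Qed.

Let inv_nbhs g V : nbhs (inv g) V -> nbhs g (inv @^-1` V).
Proof. by move=> Vg; case: tgG => _ _ cI; apply: cI. Qed.

Lemma cocycle0 x : F 0 x = e.
Proof.
have := Fadd 0 0 x; rewrite addr0 (me_0 me) => /(congr1 (mul (inv (F 0 x)))).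
by rewrite mulV mulA mulV mul1.
Qed.

Lemma cocycleN n x : F (- n) (Tz n x) = inv (F n x).
Proof.
have := Fadd (- n) n x; rewrite addNr cocycle0 => /(congr1 (mul^~ (inv (F n x)))).
by rewrite -mulA mulxV mulx1 mul1.
Qed.

Lemma cocycleB n m x : F (n - m) (Tz m x) = mul (F n x) (inv (F m x)).
Proof. by rewrite Fadd -Tadd addNr (me_0 me) cocycleN. Qed.

Lemma cocycle_nbhs_near n x V : nbhs (F n x) V ->
  exists W, [/\ open W, W x, W `<=` [set y | V (F n y)] &
    exists2 dl : R, 0 < dl & forall m y, near_id Tz dl m -> W y -> V (F n (Tz m y))].
Proof. by move=> Vn; apply: (near_id_nbhs Tz (cc_continuous cc Vn)). Qed.

(* The times [n] with [T^n] close to the identity and [sg (F n _) <= r] on [U]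
   are stable under sum and difference, because no value of [sg] lies in
   [(r, r']]; total boundedness of [X] then makes them syndetic. *)
Lemma gap_syndetic (sg : G -> R) (U : set X) (r r' dl0 : R) :
  continuous sg -> sg e = 0 -> 0 < r -> r < r' ->
  (forall g h, sg g <= r -> sg h <= r -> sg (mul g h) <= r') ->
  (forall g h, sg g <= r -> sg h <= r -> sg (mul g (inv h)) <= r') ->
  open U -> connected U -> U !=set0 -> 0 < dl0 ->
  (forall n x, U x -> near_id Tz dl0 n -> sg (F n x) <= r' -> sg (F n x) <= r) ->
  recurrent_cocycle ->
  exists M : nat, forall k : int, exists n : int,
    (`|k - n| <= M)%N /\ forall y, U y -> sg (F n y) <= r.
Proof.
move=> csg sge r0 rr' sgM sgD oU cU [x0 Ux0] dl00 gap rec.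
wlog ballU : dl0 dl00 gap / ball x0 dl0 `<=` U.
  move=> wl; have /nbhs_ballP[d /= d0 dU] : nbhs x0 U by exact: open_nbhs_nbhs.
  apply: (wl (Num.min d dl0)); first by rewrite lt_min d0.
    by move=> n x Ux nn; apply: gap => //; apply: near_id_le nn; rewrite ge_min lexx orbT.
  by apply: subset_trans dU; apply: le_ball; rewrite ge_min lexx.
(* Inside [U] the conditions [sg < r'] and [sg <= r] on [F n] agree, so they cut out a relatively
   open and closed set. It is nonempty, hence all of the connected set [U]. *)
have spread n x : near_id Tz dl0 n -> U x -> sg (F n x) <= r' ->
    forall y, U y -> sg (F n y) <= r.
  move=> nn Ux sx.
  have cs : continuous (sg \o F n).
    by move=> y; apply: continuous_comp; [exact: (cc_continuous cc)|exact: csg].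
  have <- : U `&` [set y | sg (F n y) <= r] = U; last by move=> y [].
  apply: cU.
  - by exists x; split=> //; exact: gap.
  - exists [set y | sg (F n y) < r'].
      apply: (@open_comp _ _ (sg \o F n) [set z | z < r']); last exact: open_lt.
      by move=> y _; exact: cs.
    apply/seteqP; split=> y [Uy /= sy]; split=> //; last by apply: gap => //; exact: ltW.
    exact: le_lt_trans sy rr'.
  - exists [set y | sg (F n y) <= r] => //.
    apply: (@closed_comp _ _ (sg \o F n) [set z | z <= r]); last exact: closed_le.
    by move=> y _; exact: cs.
pose N (dl : R) n := near_id Tz dl n /\ forall y, U y -> sg (F n y) <= r.
have TU dl n : dl <= dl0 -> N dl n -> U (Tz n x0).
  by move=> ddl [nn _]; apply: ballU; exact: (near_id_le ddl nn).
have ND d1 d2 n m : 0 < d1 -> 0 < d2 -> d1 + d2 <= dl0 -> N d1 n -> N d2 m -> N (d1 + d2) (n + m).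
  move=> d10 d20 d12 Nn Nm; split; first by apply: near_idD Nn.1 Nm.1.
  apply: (@spread _ x0) => //.
    by apply: near_id_le d12 _; apply: near_idD Nn.1 Nm.1.
  rewrite Fadd; apply: sgM; last exact: Nm.2.
  by apply: Nn.2; apply: TU Nm; apply: le_trans d12; rewrite lerDr ltW.
have NB dl n m : N dl0 n -> N dl0 m -> 0 < dl -> dl <= dl0 -> near_id Tz dl (n - m) -> N dl (n - m).
  move=> Nn Nm dl_0 ddl nn; split=> //.
  apply: (@spread _ (Tz m x0)); [exact: near_id_le nn|exact: TU Nm|].
  by rewrite cocycleB; apply: sgD; [exact: Nn.2|exact: Nm.2].
have N0 : N dl0 0.
  by split; [exact: near_id0|move=> y _; rewrite cocycle0 sge ltW].
have NN dl n : 0 < dl -> dl <= dl0 -> N dl n -> N dl (- n).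
  move=> dl_0 ddl Nn; rewrite -[- n]add0r; apply: NB => //.
    by split; [exact: near_id_le Nn.1|exact: Nn.2].
  by rewrite add0r; apply: near_idN Nn.1.
have Nne dl : 0 < dl -> dl <= dl0 -> exists n, n != 0 /\ N dl n.
  move=> dl_0 ddl; have [eta eta0 nE] := me_near me dl_0.
  pose ee := Num.min (eta / 2) dl0.
  have ee0 : 0 < ee by rewrite lt_min divr_gt0.
  have [||||n [n0 [x [Ux UTx sx]]]] := rec [set g | sg g < r] (ball x0 ee)°.
  - by apply: (@open_comp _ _ sg [set z | z < r]) => [y _|]; [exact: csg|exact: open_lt].
  - by rewrite /= sge.
  - exact: open_interior.
  - by exists x0; exact: nbhsx_ballx.
  move: Ux UTx => /interior_subset Ux /interior_subset UTx.
  have nn : near_id Tz dl n.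
    apply: (nE n x); apply: (@ball_split _ _ x0).
      by apply/ball_sym; apply: le_ball Ux; rewrite ge_min lexx.
    by apply: le_ball UTx; rewrite ge_min lexx.
  exists n; split=> //; split=> //; apply: (@spread _ x); first exact: near_id_le nn.
    by apply: ballU; apply: le_ball Ux; rewrite ge_min lexx orbT.
  exact/ltW/(lt_trans sx).
(* Doubling a positive time of [N (dl / 2)] gives a larger time in [N dl], so times in [N dl] are
   unbounded. *)
have Nbig k dl : 0 < dl -> dl <= dl0 -> exists n, (k%:Z < n)%R /\ N dl n.
  elim: k dl => [|k IH] dl dl_0 ddl.
    have [n [n0 Nn]] := Nne dl dl_0 ddl.
    have [np|nn] := ltP 0 n; first by exists n.
    by exists (- n); split; [lia|exact: NN].
  have d20 : 0 < dl / 2 by rewrite divr_gt0.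
  have [||n [kn Nn]] := IH (dl / 2) => //.
    by apply: le_trans ddl; rewrite ler_pdivrMr// ler_peMr ?ltW// ltrDl.
  exists (n + n); split; first by lia.
  by rewrite (splitr dl); apply: ND => //; rewrite -splitr.
have d20 : 0 < dl0 / 2 by rewrite divr_gt0.
have d2le : dl0 / 2 <= dl0 by rewrite ler_pdivrMr// ler_peMr ?ltW// ltrDl.
have [s [sN sP]] := near_id_finite me x0 (N dl0) d20.
have [B sB] : exists B : nat, {in s, forall m : int, (`|m| <= B)%N}.
  elim: (s) => [|m t [B IH]]; first by exists 0%N.
  exists (maxn `|m| B) => k; rewrite inE => /predU1P[->|/IH]; first by rewrite leq_maxl.
  by move=> /leq_trans; apply; rewrite leq_maxr.
have [p [Bp Np]] := Nbig B (dl0 / 2) d20 d2le.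
(* Subtracting the representative [m] brings [n] into [N (dl0 / 2)], which leaves room to add [p].
   As [p] exceeds [B] and [B] bounds [m], the net step [p - m] is positive and at most [p + B]. *)
have next n : N dl0 n -> exists m, [/\ N dl0 m, (n < m)%R & (m <= n + p + B%:Z)%R].
  move=> Nn; have [m ms nm] := sP n Nn.
  exists ((n - m) + p); split.
  - rewrite [dl0]splitr; apply: ND => //; first by rewrite -splitr.
    by apply: NB => //; exact: sN.
  - by have := sB m ms; lia.
  - by have := sB m ms; lia.
have pos (k : nat) : exists n, [/\ N dl0 n, (n <= k%:Z)%R & (k%:Z <= n + p + B%:Z)%R].
  elim: k => [|k [n [Nn nk kn]]]; first by exists 0; split=> //; lia.
  have [kn'|kn'] := leP k.+1%:Z (n + p + B%:Z).
    by exists n; split=> //; lia.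
  have [m [Nm nm mn]] := next n Nn.
  by exists m; split=> //; lia.
exists (`|p| + B)%N => k.
have [k0|k0] := leP 0 k.
  have [n [Nn nk kn]] := pos `|k|%N.
  by exists n; split; [lia|exact: Nn.2].
have [n [Nn nk kn]] := pos `|k|%N.
exists (- n); split; first by lia.
by have [] := NN _ _ dl00 (lexx _) Nn.
Qed.

Local Notation near_id := (near_id Tz).

Lemma ess_at_inv x g : ess_at x g -> ess_at x (inv g).
Proof.
move=> xg U V dl Ux Vg dl0.
have [W [oW Wx _ [d d0 dW]]] := near_id_nbhs Tz Ux.
have [|||n [y [nn Wy Vy]]] := xg W (inv @^-1` V) (Num.min dl d).
- exact: open_nbhs_nbhs.
- exact: inv_nbhs.
- by rewrite lt_min dl0.
exists (- n), (Tz n y); split.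
- by apply: near_idN => //; apply: near_id_le nn; rewrite ge_min lexx.
- by apply: dW => //; apply: near_id_le nn; rewrite ge_min lexx orbT.
- by rewrite cocycleN.
Qed.

(** Run first for a time [m] that realises [h] near [y], then for the time [n]. Since [m] is close
    to the identity, [F n] at the intermediate point is still close to [F n y]. *)
Lemma ess_at_extend n y U V h (dl : R) : near_id dl n -> nbhs y U -> ess h ->
  nbhs (mul (F n y) h) V -> 0 < dl ->
  exists m z, [/\ near_id (dl + dl) m, U z & V (F m z)].
Proof.
move=> nn Uy hh Vgh dl0; have [V1 [V2 [V1g V2h sV]]] := mul_nbhs Vgh.
have [W [oW Wy _ [d d0 dW]]] := cocycle_nbhs_near V1g.
have [|||m [z [nm [Uz Wz] V2z]]] := hh y (U `&` W) V2 (Num.min dl d) => //.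
- by apply: filterI => //; exact: open_nbhs_nbhs.
- by rewrite lt_min dl0.
exists (n + m), z; split=> //.
  by apply: near_idD => //; apply: near_id_le nm; rewrite ge_min lexx.
rewrite Fadd; apply: sV => //; apply: dW => //.
by apply: near_id_le nm; rewrite ge_min lexx orbT.
Qed.

(** The right factor has to be realised at a point [y] merely close to [x]; this is why it is taken
    in [ess]. *)
Lemma ess_at_mul x g h : ess_at x g -> ess h -> ess_at x (mul g h).
Proof.
move=> xg hh U V dl Ux /nbhs_interior/mul_nbhs[V1 [V2 [V1g V2h sV]]] dl0.
have d20 : 0 < dl / 2 by rewrite divr_gt0.
have [n [y [nn Uy Vy]]] := xg U° V1 (dl / 2) (nbhs_interior Ux) V1g d20.
have [|m [z [nm Uz Vz]]] := @ess_at_extend n y U V h _ nn Uy hh _ d20.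
  by apply: sV => //; exact: nbhs_singleton.
by exists m, z; split=> //; rewrite [dl]splitr.
Qed.

(** For [m] close to the identity, the value [F m (Tz n y)] equals [F n (Tz m y)] times [F m y]
    times the inverse of [F n y], and the outer factors tend to [F n x] and its inverse. *)
Lemma ess_at_conj x g n : ess_at x g ->
  ess_at (Tz n x) (mul (mul (F n x) g) (inv (F n x))).
Proof.
move=> xg U V dl UTx /mul_nbhs[V12 [V3 [/mul_nbhs[V1 [V2 [V1g V2g sV12]]] V3g sV]]] dl0.
have UTx' : nbhs x (Tz n @^-1` U) by apply: (me_continuous me).
have [W [oW Wx sW [d d0 dW]]] := cocycle_nbhs_near (filterI V1g (inv_nbhs V3g)).
have [||m [y [nm [Uy Wy] V2y]]] := xg (Tz n @^-1` U `&` W) V2 (Num.min dl d) _ V2g.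
- by apply: filterI => //; exact: open_nbhs_nbhs.
- by rewrite lt_min dl0.
exists m, (Tz n y); split=> //; first by apply: near_id_le nm; rewrite ge_min lexx.
rewrite -{1}[m](addrK n) cocycleB addrC Fadd.
apply: sV; last by have [] := sW _ Wy.
apply: sV12 => //; have [] // := dW m y _ Wy.
by apply: near_id_le nm; rewrite ge_min lexx orbT.
Qed.

Lemma ess_at_limit x g :
  (forall U V, nbhs x U -> nbhs g V -> exists y h, [/\ U y, V h & ess_at y h]) ->
  ess_at x g.
Proof.
move=> lim U V dl /nbhs_interior Ux /nbhs_interior Vg dl0.
by have [y [h [Uy Vh yh]]] := lim _ _ Ux Vg; exact: yh.
Qed.

Lemma ess_inv g : ess g -> ess (inv g).
Proof. by move=> gg x; apply: ess_at_inv. Qed.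

Lemma ess_mul g h : ess g -> ess h -> ess (mul g h).
Proof. by move=> gg hh x; apply: ess_at_mul. Qed.

Lemma ess_limit g : (forall V, nbhs g V -> exists2 h, V h & ess h) -> ess g.
Proof.
move=> lim x; apply: ess_at_limit => U V Ux Vg.
have [h Vh hh] := lim V Vg; exists x, h; split=> //; exact: nbhs_singleton.
Qed.

(** Conjugation is trivial, so essential values are constant along an orbit; orbits are dense and
    the relation is closed. *)
Lemma ess_at_abelian x g : (forall g h, mul g h = mul h g) -> ess_at x g -> ess g.
Proof.
move=> mulC xg y; apply: ess_at_limit => U V Uy Vg.
have [||n UT] := me_dense me x (U := U°).
- exact: open_interior.
- by exists y.
exists (Tz n x), g; split; [exact: interior_subset UT|exact: nbhs_singleton|].
have := @ess_at_conj x g n xg.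
by rewrite [mul (F n x) g]mulC -mulA mulxV mulx1.
Qed.

Lemma orbit_ess_at_sub x g : orbit_ess_at x g -> ess_at x g.
Proof.
move=> xg U V dl Ux Vg dl0; have [n [nn Vn]] := xg V dl Vg dl0.
by exists n, x; split=> //; exact: nbhs_singleton.
Qed.

Lemma orbit_ess_at1 x : orbit_ess_at x e.
Proof.
move=> V dl Vg dl0; exists 0; split; first exact: near_id0.
by rewrite cocycle0; exact: nbhs_singleton.
Qed.

Lemma orbit_ess_at_extend x n h U V : orbit_ess_at x h -> nbhs (Tz n x) U ->
  nbhs (mul (F n x) h) V -> exists m, U (Tz m x) /\ V (F m x).
Proof.
move=> xh Ux /mul_nbhs[V1 [V2 [V1g V2h sV]]].
have [W [oW Wx _ [d d0 dW]]] := cocycle_nbhs_near V1g.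
have /(near_id_into Tz)[d' d'0 dU] : nbhs x (Tz n @^-1` U).
  by apply: (me_continuous me).
have [|m [nm V2m]] := xh V2 (Num.min d d') V2h; first by rewrite lt_min d0.
exists (n + m); split.
  by rewrite Tadd; apply: dU; apply: near_id_le nm; rewrite ge_min lexx orbT.
rewrite Fadd; apply: sV => //; apply: dW => //.
by apply: near_id_le nm; rewrite ge_min lexx.
Qed.

Lemma orbit_ess_at_mul x g h :
  orbit_ess_at x g -> orbit_ess_at x h -> orbit_ess_at x (mul g h).
Proof.
move=> xg xh V dl /mul_nbhs[V1 [V2 [V1g V2h sV]]] dl0.
have d20 : 0 < dl / 2 by rewrite divr_gt0.
have [n [nn V1n]] := xg V1° (dl / 2) (nbhs_interior V1g) d20.
have [W [oW Wx _ [d d0 dW]]] := cocycle_nbhs_near V1n.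
have [|m [nm V2m]] := xh V2 (Num.min (dl / 2) d) V2h; first by rewrite lt_min d20.
exists (n + m); split.
  by rewrite [dl]splitr; apply: near_idD => //; apply: near_id_le nm; rewrite ge_min lexx.
rewrite Fadd; apply: sV => //; apply: dW => //.
by apply: near_id_le nm; rewrite ge_min lexx orbT.
Qed.

(** [O (i, k)] is the open set of points whose own orbit meets [V i] at a time [1/(k+1)]-close to
    the identity. Baire gives a point lying, for each pair, in [O (i, k)] or outside its closure;
    the second is excluded when [V i] is met from points arbitrarily near [x0]. *)
Lemma exists_generic_point (I : countType) (V : I -> set G) (x1 : X) :
  (forall i, open (V i)) ->
  exists x0, forall i,
    (forall U (dl : R), nbhs x0 U -> 0 < dl ->
      exists n y, [/\ near_id dl n, U y & V i (F n y)]) ->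
    forall dl : R, 0 < dl -> exists n, near_id dl n /\ V i (F n x0).
Proof.
move=> oV.
pose O (ik : I * nat) := [set x | exists n, near_id ik.2.+1%:R^-1 n /\ V ik.1 (F n x)].
have oO ik : open (O ik).
  rewrite openE => x [n [nn Vn]].
  have : nbhs x (F n @^-1` V ik.1).
    by apply: (cc_continuous cc); exact: open_nbhs_nbhs.
  by apply: filterS => y Vy; exists n.
(* Numbers coding no pair get the whole space, which does not affect the intersection. *)
pose O' j := if unpickle j is Some ik then O ik `|` ~` closure (O ik) else setT.
have [||i|i W oW [w Ww]|x0 _ x0P] := @compact_baire R X O' setT (me_compact me).
- exact: openT.
- by exists x1.
- rewrite /O'; case: unpickle => [ik|]; last exact: openT.
  by apply: openU => //; apply: closed_openC; exact: closed_closure.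
- rewrite /O'; case: unpickle => [ik|]; last by exists w.
  have [cw|ncw] := pselect (closure (O ik) w).
    have [z [Oz Wz]] := cw W (open_nbhs_nbhs (conj oW Ww)).
    by exists z; split=> //; left.
  by exists w; split=> //; right.
exists x0 => i xi dl dl0.
have [k kdl] : exists k : nat, k.+1%:R^-1 <= dl.
  have [k _ /(_ k (leqnn _)) kdl] := near_infty_natSinv_lt (PosNum dl0).
  by exists k; exact: ltW.
have [n [nn Vn]] : O (i, k) x0.
  have := x0P (pickle (i, k)); rewrite /O' pickleK => -[//|[]] U Ux.
  have [|n [y [nn Uy Vy]]] := xi U k.+1%:R^-1 Ux; first by rewrite invr_gt0.
  by exists y; split=> //; exists n.
by exists n; split=> //; exact: near_id_le nn.
Qed.

(** Move a given [x] to [z] in [U0]. As [Tz n x0] tends to [z], the corrected values in [K]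
    accumulate at some [k]. Right factors from [orbit_ess_at x0] are absorbed by near-identity
    times, so [(z, k)] is in the orbit closure, and moving back gives a point above [x]. *)
Lemma orbit_closure_onto x0 (K : set G) (U0 : set X) :
  compact K -> open U0 -> U0 !=set0 ->
  (forall U, open U -> U !=set0 -> U `<=` U0 ->
    exists n h, [/\ U (Tz n x0), orbit_ess_at x0 h & K (mul (F n x0) h)]) ->
  fst @` closure [set (Tz n x0, mul (F n x0) e) | n in [set: int]] = [set: X].
Proof.
move=> cK oU0 U00 dK; apply/seteqP; split=> // x _.
have [j U0x] := me_dense me x oU0 U00.
set z := Tz j x in U0x.
pose P (d : R) (k : G) := exists n h,
  [/\ ball z d (Tz n x0), orbit_ess_at x0 h & k = mul (F n x0) h].
have [|d d0|k Kk kP] := compact_limit (P := P) cK.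
- move=> d1 d2 d12 k [n [h [zn xh kE]]].
  by exists n, h; split=> //; exact: le_ball zn.
- have [||y|n [h [[zn _] xh Kn]]] := dK ((ball z d)° `&` U0).
  + by apply: openI => //; exact: open_interior.
  + by exists z; split=> //; exact: nbhsx_ballx.
  + by move=> [].
  by exists (mul (F n x0) h) => //; exists n, h; split=> //; exact: interior_subset zn.
have TNz : Tz (- j) z = x by rewrite /z -Tadd addNr (me_0 me).
exists (x, mul (F (- j) z) k) => // B [[B1 B2] [/= B1x B2k] sB].
have [V1 [V2 [V1g V2h sV]]] := mul_nbhs B2k.
have : nbhs z ((Tz (- j) @^-1` B1°) `&` (F (- j) @^-1` V1°)).
  apply: filterI.
    by apply: (me_continuous me); rewrite TNz; exact: nbhs_interior.
  by apply: (cc_continuous cc); exact: nbhs_interior.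
move=> /nbhs_interior/nbhs_ballP[d /= d0 zB].
have [k' V2n [n [h [zn xh k'E]]]] := kP V2° d (nbhs_interior V2h) d0.
rewrite k'E in V2n.
have [m [[B1m V1m] V2m]] := orbit_ess_at_extend xh (zB _ zn) V2n.
exists (Tz (- j + m) x0, mul (F (- j + m) x0) e); split; first by exists (- j + m).
apply: sB; split=> /=; first by rewrite Tadd; exact: interior_subset B1m.
rewrite mulx1 Fadd; apply: sV => //; exact: interior_subset V1m.
Qed.

End Cocycles.

(** * Matrices, closed subgroups and linear flows *)

Section Matrices.
Variable R : realType.

Lemma entry_le_norm m n (M : 'M[R]_(m, n)) i j : `|M i j| <= `|M|.
Proof.
rewrite [leRHS]/Num.norm /= mx_normrE.
by apply: (@le_trans _ _ `|M (i, j).1 (i, j).2|); last exact: le_bigmax.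
Qed.

Lemma mx_norm_le m n (M : 'M[R]_(m, n)) (c : R) : 0 <= c ->
  (forall i j, `|M i j| <= c) -> `|M| <= c.
Proof.
move=> c0 Mc; rewrite [leLHS]/Num.norm /= mx_normrE.
by apply: bigmax_le => // -[i j] _; exact: Mc.
Qed.

Lemma norm_mulmx_le m n k (M : 'M[R]_(m, n)) (N : 'M[R]_(n, k)) :
  `|M *m N| <= n%:R * `|M| * `|N|.
Proof.
apply: mx_norm_le => [|i j]; first by rewrite !mulr_ge0.
rewrite mxE (le_trans (ler_norm_sum _ _ _))//.
rewrite (le_trans (y := \sum_(l < n) `|M| * `|N|))//.
  by apply: ler_sum => l _; rewrite normrM ler_pM// entry_le_norm.
by rewrite sumr_const card_ord -mulrA mulr_natl.
Qed.

Lemma continuous_mx (T : topologicalType) m n (f : T -> 'M[R]_(m, n)) :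
  (forall i j, continuous (fun t => f t i j)) -> continuous f.
Proof.
move=> cf t; apply/cvg_ballP => e e0.
have : \forall s \near t, forall ij : 'I_m * 'I_n, ball (f t ij.1 ij.2) e (f s ij.1 ij.2).
  apply: filter_forall => -[i j] /=.
  by have /cvg_ballP/(_ e e0) := cf i j t.
by apply: filterS => s H; split=> // i j; exact: (H (i, j)).
Qed.

Lemma mulmx_continuous m n k :
  continuous (fun p : 'M[R]_(m, n) * 'M[R]_(n, k) => p.1 *m p.2).
Proof.
apply: continuous_mx => i j.
have -> : (fun t : 'M[R]_(m, n) * 'M[R]_(n, k) => (t.1 *m t.2) i j)
    = (fun t : 'M[R]_(m, n) * 'M[R]_(n, k) => \sum_(l < n) t.1 i l * t.2 l j).
  by apply/funext => t; rewrite mxE.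
apply: continuous_big => [|l _]; first exact: add_continuous.
move=> p; apply: (@continuousM _ _ (fun t : 'M[R]_(m, n) * 'M[R]_(n, k) => t.1 i l)
    (fun t : 'M[R]_(m, n) * 'M[R]_(n, k) => t.2 l j)).
  apply: (@continuous_comp _ _ _ fst (fun M : 'M[R]_(m, n) => M i l)).
    exact: cvg_fst.
  exact: coord_continuous.
apply: (@continuous_comp _ _ _ snd (fun M : 'M[R]_(n, k) => M l j)).
  exact: cvg_snd.
exact: coord_continuous.
Qed.

Lemma cvg_mulmx (T : Type) m n k (f : T -> 'M[R]_(m, n)) (g : T -> 'M[R]_(n, k))
    (F : set_system T) {FF : Filter F} (a : 'M[R]_(m, n)) (b : 'M[R]_(n, k)) :
  f x @[x --> F] --> a -> g x @[x --> F] --> b ->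
  (f x *m g x) @[x --> F] --> a *m b.
Proof.
move=> fa gb.
apply: (@continuous2_cvg _ _ _ _ _ _ _ _ (fun (M : 'M[R]_(m, n)) (N : 'M[R]_(n, k)) => M *m N)) => //.
exact: (mulmx_continuous (x := (a, b))).
Qed.

Lemma nbhs_distP (V : normedModType R) (x : V) (P : set V) : nbhs x P ->
  exists2 e : R, 0 < e & forall y, `|x - y| < e -> P y.
Proof.
move=> /nbhs_ballP[e /= e0 xP]; exists e => // y xy; apply: xP.
by rewrite -ball_normE.
Qed.

Lemma nbhs_dist (V : normedModType R) (x : V) (e : R) : 0 < e ->
  nbhs x [set y | `|x - y| < e].
Proof.
move=> e0; apply/nbhs_ballP; exists e => //= y.
by rewrite -ball_normE.
Qed.

Lemma compact_ball_cV d (M : R) : compact [set v : 'cV[R]_d | `|v| <= M].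
Proof.
have -> : [set v : 'cV[R]_d | `|v| <= M] =
    [set v^T | v in [set w : 'rV[R]_d | `|w^T| <= M]].
  apply/seteqP; split=> [v /= vM|_ [w /= wM <-]//].
  by exists v^T; rewrite /= trmxK.
have ctr m n : continuous (fun w : 'M[R]_(m, n) => w^T).
  apply: continuous_mx => i j; rewrite (_ : (fun _ => _) = (fun w : 'M[R]_(m, n) => w j i)).
    exact: coord_continuous.
  by apply/funext => w; rewrite mxE.
apply: continuous_compact; first exact/continuous_subspaceT/ctr.
apply: bounded_closed_compact.
  exists M; split; first exact: num_real.
  move=> x Mx w /= wM; apply: le_trans (ltW Mx); apply: le_trans wM.
  apply: mx_norm_le => // i j.
  by have := entry_le_norm w^T j i; rewrite mxE.
apply: (@closed_comp _ _ (fun w : 'rV[R]_d => `|w^T|) [set z | z <= M]); last exact: closed_le.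
move=> w _; apply: (@continuous_comp _ _ _ (fun w : 'rV[R]_d => w^T) Num.norm).
  exact: ctr.
exact: norm_continuous.
Qed.

Lemma compact_ball_cVR d (M N : R) :
  compact [set g : 'cV[R]_d * R | `|g.1| <= M /\ `|g.2| <= N].
Proof.
have -> : [set g : 'cV[R]_d * R | `|g.1| <= M /\ `|g.2| <= N] =
    [set v : 'cV[R]_d | `|v| <= M] `*` `[- N, N]%classic.
  apply/seteqP; split=> -[v u] /=; rewrite in_itv /= -ler_norml //.
by apply: compact_setX; [exact: compact_ball_cV|exact: segment_compact].
Qed.

(** A matrix of maximal rank with rows in [L] has row space [L], up to transposition. [P] is the
    transpose of the projection onto a complement along it. *)
Lemma subspace_projection d (L : set 'cV[R]_d) :
  L 0 -> (forall v w, L v -> L w -> L (v + w)) ->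
  (forall (t : R) v, L v -> L (t *: v)) ->
  exists P : 'M[R]_d, P *m P = P /\ forall v, L v <-> P *m v = 0.
Proof.
move=> L0 LD LZ.
pose Q (M : 'M[R]_d) := forall i, L (row i M)^T.
pose q := [pred n | `[< exists M, Q M /\ \rank M = n >]].
have exq : exists n, q n.
  exists 0%N; apply/asboolP; exists 0; split; last by rewrite mxrank0.
  by move=> i; rewrite row0 trmx0.
have ubq n : q n -> (n <= d)%N by move=> /asboolP[M [_ <-]]; exact: rank_leq_row.
case: (ex_maxnP exq ubq) => n /asboolP[M [QM rM]] nmax.
have Lsum (w : 'rV[R]_d) : (w <= M)%MS -> L w^T.
  move=> /submxP[D ->]; rewrite mulmx_sum_row linear_sum.
  elim/big_ind: _ => // i _; rewrite linearZ; apply: LZ; exact: QM.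
have LM v : L v <-> (v^T <= M)%MS.
  split=> [Lv|/Lsum]; last by rewrite trmxK.
  apply: contrapT => /negP nv.
  have QMv : Q (M + v^T)%MS.
    move=> i; have : (row i (M + v^T)%MS <= M + v^T)%MS by exact: row_sub.
    move=> /sub_addsmxP[[D1 D2] /= ->].
    rewrite linearD /=; apply: LD; first by apply: Lsum; exact: submxMl.
    by rewrite [D2]mx11_scalar mul_scalar_mx linearZ /= trmxK; exact: LZ.
  have : (M < M + v^T)%MS.
    rewrite ltmxE addsmxSl /=; apply: contra nv; apply: submx_trans; exact: addsmxSr.
  move=> /rank_ltmx; rewrite rM ltnNge => /negP; apply; apply: nmax.
  by apply/asboolP; exists (M + v^T)%MS.
have cap : (M^C :&: M)%MS = 0 by rewrite capmxC capmx_compl.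
pose P := (proj_mx M^C%MS M)^T.
exists P; split.
  by rewrite /P -trmx_mul proj_mx_proj.
move=> v; rewrite LM; split=> [vM|Pv].
  by apply: trmx_inj; rewrite trmx_mul trmxK trmx0 proj_mx_0.
have Pv' : v^T *m proj_mx M^C%MS M = 0 by rewrite -[proj_mx _ _]trmxK -trmx_mul Pv trmx0.
have := @proj_mx_compl_sub _ _ _ M^C%MS M v^T; rewrite Pv' subr0; apply.
by rewrite submx_full// /row_full; have := addsmx_compl_full M; rewrite addsmxC.
Qed.

End Matrices.

(** * Closed subgroups of [R^d]: a linear part, discrete transversally *)

Section ClosedSubgroups.
Variables (R : realType) (d : nat) (H : set 'cV[R]_d).
Hypothesis H0 : H 0.
Hypothesis HD : forall v w, H v -> H w -> H (v + w).
Hypothesis HN : forall v, H v -> H (- v).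
Hypothesis Hlim : forall v, (forall e : R, 0 < e -> exists2 w, H w & `|v - w| < e) -> H v.

Lemma subgroup_mulrz v (n : int) : H v -> H (n%:~R *: v).
Proof.
move=> Hv; have Hn (k : nat) : H (k%:R *: v).
  elim: k => [|k IH]; first by rewrite scale0r.
  by rewrite -natr1 scalerDl scale1r; exact: HD.
case: n => n; first exact: Hn.
by rewrite NegzE mulrNz scaleNr; apply: HN; exact: Hn.
Qed.

(** The kernel of [P] is the largest linear subspace in [H]. If [H] were not discrete modulo it,
    arbitrarily short nonzero vectors of [H] fixed by [P] would exist; their directions accumulate
    at some [u] fixed by [P], and the whole line through [u] would lie in [H]. *)
Lemma closed_subgroup_projection : exists P : 'M[R]_d,
  [/\ P *m P = P, forall v, P *m v = 0 <-> (forall t : R, H (t *: v)) &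
    exists2 eps : R, 0 < eps & forall v, H v -> `|P *m v| < eps -> P *m v = 0].
Proof.
have [|v w Lv Lw t|t v Lv s|P [PP PL]] :=
    @subspace_projection R d [set v | forall t : R, H (t *: v)].
- by move=> t; rewrite scaler0.
- by rewrite scalerDr; exact: HD.
- by rewrite scalerA.
exists P; split=> // [v|]; first by rewrite -PL.
apply: contrapT => nex.
have HP v : H v -> H (P *m v).
  move=> Hv; have /PL/(_ 1) : P *m (v - P *m v) = 0.
    by rewrite mulmxBr mulmxA PP subrr.
  rewrite scale1r => Hw; rewrite -[P *m v](subKr v).
  by apply: HD => //; exact: HN.
have small (e : R) : 0 < e -> exists v, [/\ H v, P *m v = v, 0 < `|v| & `|v| < e].
  move=> e0; apply: contrapT => ne; apply: nex; exists e => // v Hv Pve.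
  apply: contrapT => Pv0; apply: ne; exists (P *m v); split=> //; first exact: HP.
    by rewrite mulmxA PP.
  by rewrite normr_gt0; apply/eqP.
pose Q (e : R) (w : 'cV[R]_d) := exists v,
  [/\ H v, P *m v = v, 0 < `|v|, `|v| < e & w = `|v|^-1 *: v].
have Q1 e w : Q e w -> `|w| = 1 /\ P *m w = w.
  move=> [v [_ Pv v0 _ ->]]; split; last by rewrite -scalemxAr Pv.
  by rewrite normrZ normfV normr_id mulVf// gt_eqF.
have [|e e0|u _ uQ] := compact_limit (P := Q) (@compact_ball_cV R d 1).
- move=> e1 e2 e12 w [v [Hv Pv v0 ve wE]]; exists v; split=> //.
  exact: lt_le_trans e12.
- have [v [Hv Pv v0 ve]] := small e e0.
  exists (`|v|^-1 *: v); last by exists v.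
  by have [|/= ->] := Q1 e (`|v|^-1 *: v); first by exists v.
have close (e : R) : 0 < e -> exists2 w, `|u - w| < e & Q e w.
  by move=> e0; have [w] := uQ _ e (nbhs_dist u e0) e0; exists w.
have Pu : P *m u = u.
  apply/eqP; rewrite -subr_eq0 -normr_le0; apply/ler_addgt0Pl => e e0.
  rewrite addr0.
  have c0 : 0 < d%:R * `|P| + 1 by rewrite ltr_wpDl// mulr_ge0.
  have [w uw /Q1[_ Pw]] := close _ (divr_gt0 e0 c0).
  have -> : P *m u - u = P *m (u - w) - (u - w).
    by rewrite mulmxBr Pw opprB addrA subrK.
  rewrite (le_trans (ler_normB _ _))// (le_trans (y := (d%:R * `|P| + 1) * `|u - w|))//.
    by rewrite mulrDl mul1r lerD2r norm_mulmx_le.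
  by rewrite mulrC -ler_pdivlMr// ltW.
have u1 : 1 <= `|u|.
  apply/ler_addgt0Pl => e e0; have [w uw /Q1[w1 _]] := close e e0.
  by rewrite -w1 -lerBlDr (le_trans (lerB_dist _ _))// distrC ltW.
suff /PL Pu0 : forall t : R, H (t *: u).
  by move: u1; rewrite -Pu Pu0 normr0 ler10.
move=> t; apply: Hlim => e e0.
have c0 : 0 < `|t| + 1 by rewrite ltr_wpDl.
have [w uw Qw] := close _ (divr_gt0 e0 c0).
have [w1 _] := Q1 _ _ Qw; case: Qw => v [Hv Pv v0 ve wE].
(* An integer multiple of the short vector [v], within its length of [t] times its direction,
   approximates [t *: u]. *)
exists ((Num.floor (t / `|v|))%:~R *: v); first exact: subgroup_mulrz.
have /andP[fl1 fl2] := floor_itv (t / `|v|).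
have vE : v = `|v| *: w by rewrite wE scalerA divff ?gt_eqF// scale1r.
set k := Num.floor _ in fl1 fl2 *.
rewrite [in X in _ - _ *: X]vE scalerA.
have -> : t *: u - (k%:~R * `|v|) *: w = t *: (u - w) + (t - k%:~R * `|v|) *: w.
  by rewrite scalerBr scalerBl addrA subrK.
rewrite (le_lt_trans (ler_normD _ _))// !normrZ w1 mulr1.
have kv : `|t - k%:~R * `|v| | <= `|v|.
  move: fl1 fl2; rewrite ler_pdivlMr// ltr_pdivrMr// intrD mulrDl mul1r => a b.
  by rewrite ger0_norm ?subr_ge0// lerBlDl ltW.
rewrite (le_lt_trans (y := (`|t| * `|u - w| + `|v|)))// ?lerD2l//.
rewrite (lt_le_trans (y := (`|t| * (e / (`|t| + 1)) + e / (`|t| + 1))))//.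
  by rewrite ler_ltD// ler_wpM2l// ltW.
by rewrite -[X in _ + X]mul1r -mulrDl mulrC divfK// gt_eqF.
Qed.

End ClosedSubgroups.

(** * Linear flows without eigenvalue 1 and the subgroups they preserve *)

Section Flows.
Variables (R : realType) (d : nat) (A : R -> 'M[R]_d).
Hypothesis cA : continuous A.
Hypothesis A0 : A 0 = 1%:M.
Hypothesis AD : forall s t, A (s + t) = A s *m A t.
Hypothesis eigA : forall u, u != 0 -> ~~ eigenvalue (A u) 1.

Lemma flow_sub1_unit u : u != 0 -> 1%:M - A u \in unitmx.
Proof.
move=> /eigA; rewrite /eigenvalue negbK /eigenspace kermx_eq0 row_free_unit.
by rewrite -opprB -scaleN1r unitmxZ ?unitrN1.
Qed.

Lemma stable_kernelE (P N : 'M[R]_d) : P *m P = P ->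
  (forall v : 'cV[R]_d, P *m v = 0 -> P *m (N *m v) = 0) -> P *m N = P *m N *m P.
Proof.
move=> PP stab; apply/eqP; rewrite -subr_eq0 -{1}[P *m N]mulmx1 -mulmxBr.
apply/eqP/matrixP => j k.
have /stab/colP/(_ j) : P *m col k (1%:M - P) = 0.
  by rewrite colE mulmxA mulmxBr mulmx1 PP subrr mul0mx.
by rewrite colE !mulmxA -colE !mxE.
Qed.

(** The row space of [P *m N] is contained in that of [P] and has the same rank, so the two
    coincide. [D] acts as an inverse of the map induced by [N] modulo the kernel of [P]. *)
Lemma stable_kernel_inverse (P N : 'M[R]_d) :
  P *m N = P *m N *m P -> N \in unitmx -> exists D, P = D *m (P *m N).
Proof.
move=> PN uN; apply/submxP.
have le : (P *m N <= P)%MS by rewrite PN submxMl.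
by have := mxrank_leqif_sup le; rewrite mxrankMfree ?row_free_unit// => -[_ <-].
Qed.

(** For [v] in [H], the vectors [(1 - A s) v] lie in [H] and tend to 0 with [s], so by discreteness
    they fall in the kernel of [P] for some [s != 0]. Since [1 - A s] is invertible modulo this
    kernel, [v] lies in it too. *)
Lemma flow_invariant_subgroup (H : set 'cV[R]_d) :
  H 0 -> (forall v w, H v -> H w -> H (v + w)) -> (forall v, H v -> H (- v)) ->
  (forall v, (forall e : R, 0 < e -> exists2 w, H w & `|v - w| < e) -> H v) ->
  (forall s v, H v -> H (A s *m v)) ->
  exists P : 'M[R]_d, P *m P = P /\ forall v, H v <-> P *m v = 0.
Proof.
move=> H0 HD HN Hlim HA.
have [P [PP PL [eps eps0 gap]]] := closed_subgroup_projection H0 HD HN Hlim.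
exists P; split=> // v; split=> [Hv|/PL/(_ 1)]; last by rewrite scale1r.
have cPA : continuous (fun s => P *m ((1%:M - A s) *m v)).
  move=> s; apply: cvg_mulmx; first exact: cvg_cst.
  apply: cvg_mulmx; last exact: cvg_cst.
  by apply: cvgB; [exact: cvg_cst|exact: cA].
have [s s0 Ps] : exists2 s, s != 0 & P *m ((1%:M - A s) *m v) = 0.
  have : nbhs (0 : R) [set s | `|P *m ((1%:M - A 0) *m v) - P *m ((1%:M - A s) *m v)| < eps].
    exact: (cPA 0 _ (nbhs_dist _ eps0)).
  move=> /nbhs_distP[e e0 he]; exists (e / 2); first by rewrite gt_eqF// divr_gt0.
  apply: gap.
    by rewrite mulmxBl mul1mx; apply: HD => //; apply: HN; exact: HA.
  have := he (e / 2); rewrite /= A0 subrr mul0mx mulmx0 !sub0r !normrN; apply.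
  by rewrite gtr0_norm ?divr_gt0// ltr_pdivrMr// ltr_pMr// ltrDl.
have PN : P *m (1%:M - A s) = P *m (1%:M - A s) *m P.
  apply: stable_kernelE => // w /PL Hw; apply/PL => t.
  rewrite mulmxBl mul1mx scalerBr; apply: HD => //; apply: HN.
  by rewrite scalemxAr; exact: HA.
have [D DE] := stable_kernel_inverse PN (flow_sub1_unit s0).
by rewrite DE -!mulmxA Ps mulmx0.
Qed.

End Flows.

Section FlowEstimates.
Variables (R : realType) (d : nat) (A : R -> 'M[R]_d).
Hypothesis cA : continuous A.
Hypothesis A0 : A 0 = 1%:M.
Hypothesis AD : forall s t, A (s + t) = A s *m A t.

Lemma flow_bounded (M : R) : 0 <= M ->
  exists2 k : R, 1 <= k & forall u, `|u| <= M -> `|A u| <= k.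
Proof.
move=> M0.
have [||c _ cmax] := @EVT_max R (fun u => `|A u|) (- M) M.
- by rewrite ge0_cp.
- apply: continuous_subspaceT => u.
  by apply: (@continuous_comp _ _ _ A Num.norm); [exact: cA|exact: norm_continuous].
exists (Num.max 1 `|A c|); first by rewrite le_max lexx.
by move=> u; rewrite ler_norml => uM; rewrite le_max cmax ?orbT// in_itv.
Qed.

Section Escape.
Hypothesis eigA : forall u, u != 0 -> ~~ eigenvalue (A u) 1.
Variable P : 'M[R]_d.
Hypothesis PP : P *m P = P.
Hypothesis PA : forall u, P *m A u = P *m A u *m P.

Let P1A u : P *m (1%:M - A u) = P *m (1%:M - A u) *m P.
Proof. by rewrite mulmxBr mulmx1 mulmxBl PP -PA. Qed.

Lemma flow_projection_bounded : exists2 k : R, 1 <= k &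
  forall u (v : 'cV[R]_d), `|u| <= 1 -> `|P *m (A u *m v)| <= k * `|P *m v|.
Proof.
have [k k1 kP] := flow_bounded ler01.
exists (1 + d%:R * (d%:R * `|P| * k)).
  by rewrite lerDl !mulr_ge0// (le_trans _ k1).
move=> u v u1; rewrite mulmxA PA -mulmxA.
apply: le_trans (norm_mulmx_le _ _) _; rewrite ler_wpM2r//.
apply: (@le_trans _ _ (d%:R * (d%:R * `|P| * k))); last by rewrite lerDr.
rewrite ler_wpM2l//; apply: le_trans (norm_mulmx_le _ _) _.
by rewrite ler_wpM2l ?mulr_ge0// kP.
Qed.

(** The vectors [(1 - A (n u)) p] are the translation parts of the powers of the map of rotation
    part [A u] fixing [p]. If [p] is far away, they are large modulo the kernel of [P] when [n u] is
    close to [eta]. They grow by at most 1 per step, so the first one of size at least 1 has size at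
    most 2. *)
Lemma flow_escape (eta : R) : 0 < eta -> exists M tau : R, 0 < tau /\
  forall (p : 'cV[R]_d) u, M <= `|P *m p| -> 0 < u -> u <= tau ->
    `|P *m ((1%:M - A u) *m p)| <= tau ->
    exists n : nat, [/\ n%:R * u <= eta,
      1 <= `|P *m ((1%:M - A (n%:R * u)) *m p)| &
      `|P *m ((1%:M - A (n%:R * u)) *m p)| <= 2].
Proof.
wlog eta1 : eta / eta <= 1.
  move=> wl eta0; have [||M [tau [tau0 H]]] := wl (Num.min eta 1).
  - by rewrite ge_min lexx orbT.
  - by rewrite lt_min eta0 ltr01.
  exists M, tau; split=> // p u Mp u0 ut pt.
  have [n [nu n1 n2]] := H p u Mp u0 ut pt; exists n; split=> //.
  by apply: le_trans nu _; rewrite ge_min lexx.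
move=> eta0.
have [k k1 kP] := flow_projection_bounded.
have k0 : 0 < k by exact: lt_le_trans k1.
have [D DE] := stable_kernel_inverse (P1A eta) (flow_sub1_unit eigA (lt0r_neq0 eta0)).
pose C := d%:R * `|D| + 1.
have C0 : 0 < C by rewrite ltr_wpDl// mulr_ge0.
have CP p : `|P *m p| <= C * `|P *m ((1%:M - A eta) *m p)|.
  rewrite {1}DE -!mulmxA; apply: le_trans (norm_mulmx_le _ _) _.
  by rewrite ler_wpM2r// lerDl.
have [e e0 eP] : exists2 e : R, 0 < e & forall th, `|th| < e ->
    d%:R * `|P *m (1%:M - A th)| <= (2 * C * k)^-1.
  have c : P *m (1%:M - A x) @[x --> (0 : R)] --> P *m (1%:M - A 0).
    apply: cvg_mulmx; first exact: cvg_cst.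
    by apply: cvgB; [exact: cvg_cst|exact: cA].
  have q0 : 0 < (2 * C * k)^-1 / (d%:R + 1).
    by rewrite divr_gt0 ?invr_gt0 ?mulr_gt0// ltr_wpDl.
  have /nbhs_distP[e e0 he] := c _ (nbhs_dist _ q0).
  exists e => // th the.
  have := he th; rewrite /= A0 subrr mulmx0 !sub0r !normrN => /(_ the) /ltW h.
  have d0 : (0 : R) <= d%:R by [].
  apply: le_trans (ler_wpM2l d0 h) _.
  rewrite mulrA ler_pdivrMr ?ltr_wpDl// mulrC ler_wpM2l//.
    by rewrite invr_ge0 !mulr_ge0// ltW.
  by rewrite lerDl.
(* The bound [e / 2] puts the last multiple of [u] before [eta] within [e] of it; the bound [k^-1]
   makes each increment at most 1. *)
pose tau := Num.min (e / 2) k^-1.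
exists (2 * C), tau; split; first by rewrite lt_min divr_gt0// invr_gt0.
move=> p u Mp u0 ut pt.
pose val n := `|P *m ((1%:M - A (n%:R * u)) *m p)|.
pose n0 := Num.trunc (eta / u).
have /andP[n01 n02] : n0%:R <= eta / u < n0.+1%:R by apply: truncn_itv; rewrite divr_ge0// ltW.
have n0u : n0%:R * u <= eta by rewrite -ler_pdivlMr.
have val0 : 1 <= val n0.
  pose th := eta - n0%:R * u.
  have th0 : `|th| < e.
    rewrite ger0_norm ?subr_ge0//.
    apply: (@lt_le_trans _ _ u).
      by rewrite ltrBlDl -[X in _ + X]mul1r -mulrDl natr1 -ltr_pdivrMr.
    apply: le_trans ut _; rewrite ge_min; apply/orP; left.
    by rewrite ler_pdivrMr// ler_peMr ?ltW// ltrDl.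
  (* The displacement at [n0 u] is the one at [eta], at least [|P p| / C], minus an error of at most
     half that bound; hence the threshold [2 * C]. *)
  have -> : val n0 = `|P *m ((1%:M - A eta) *m p)
       - P *m (A (n0%:R * u) *m ((1%:M - A th) *m p))|.
    rewrite /val -mulmxBr; congr (`|_ *m _|).
    rewrite !mulmxA -mulmxBl; congr (_ *m _).
    rewrite mulmxBr mulmx1 -AD /th [_ + (eta - _)]addrC subrK opprB.
    by rewrite addrA subrK.
  apply: le_trans (lerB_dist _ _).
  have a1 : `|P *m p| / C <= `|P *m ((1%:M - A eta) *m p)|.
    by rewrite ler_pdivrMr// mulrC.
  have a2 : `|P *m (A (n0%:R * u) *m ((1%:M - A th) *m p))| <= `|P *m p| / (2 * C).
    apply: le_trans (kP _ _ _) _.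
      by rewrite ger0_norm ?mulr_ge0 ?(ltW u0)// (le_trans n0u).
    rewrite mulmxA P1A -mulmxA.
    apply: (@le_trans _ _ (k * ((2 * C * k)^-1 * `|P *m p|))).
      rewrite ler_wpM2l ?(ltW k0)//; apply: le_trans (norm_mulmx_le _ _) _.
      by rewrite ler_wpM2r// eP.
    rewrite le_eqVlt; apply/orP; left; apply/eqP.
    by rewrite invfM; field; rewrite !gt_eqF.
  apply: le_trans (lerB a1 a2).
  have -> : `|P *m p| / C - `|P *m p| / (2 * C) = `|P *m p| / (2 * C).
    by field; rewrite gt_eqF.
  by rewrite ler_pdivlMr ?mulr_gt0// mul1r.
have exn : exists n, 1 <= val n by exists n0.
(* The first [n] with value at least 1: it is not 0, and its predecessor has value below 1. *)
case: (ex_minnP exn) => n valn nmin.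
exists n; split=> //.
  by apply: le_trans n0u; rewrite ler_wpM2r ?(ltW u0)// ler_nat nmin.
case: n valn nmin => [|n] valn nmin.
  by move: valn; rewrite /val mul0r A0 subrr mul0mx mulmx0 normr0 ler10.
have vn : val n < 1.
  by rewrite ltNge; apply/negP => /nmin; rewrite ltnn.
rewrite -/(val n.+1).
have -> : val n.+1 = `|P *m ((1%:M - A (n%:R * u)) *m p)
     + P *m (A (n%:R * u) *m ((1%:M - A u) *m p))|.
  rewrite /val -mulmxDr; congr (`|_ *m _|).
  rewrite !mulmxA -mulmxDl; congr (_ *m _).
  rewrite mulmxBr mulmx1 -AD -[in LHS]natr1 mulrDl mul1r.
  by rewrite addrA subrK.
apply: le_trans (ler_normD _ _) _; apply: (lerD (ltW vn)).
have nu1 : n.+1%:R * u <= 1.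
  apply: le_trans eta1; apply: le_trans n0u.
  by rewrite ler_wpM2r ?(ltW u0)// ler_nat nmin.
apply: le_trans (kP _ _ _) _.
  rewrite ger0_norm ?mulr_ge0 ?(ltW u0)//; apply: le_trans nu1.
  by rewrite ler_wpM2r ?(ltW u0)// ler_nat.
rewrite mulrC -ler_pdivlMr// div1r; apply: le_trans pt _.
by rewrite ge_min lexx orbT.
Qed.

End Escape.

Lemma sdp_topological_group :
  topological_group (sdp_mul A) (sdp_inv A) (sdp_one R d).
Proof.
have AV u : A u *m A (- u) = 1%:M by rewrite -AD subrr A0.
split; first split.
- move=> [v u] [v' u'] [v'' u'']; rewrite /sdp_mul /= mulmxDr !mulmxA -AD.
  by rewrite !addrA.
- by move=> [v u]; rewrite /sdp_mul /= A0 mul1mx !add0r.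
- by move=> [v u]; rewrite /sdp_mul /= mulmx0 !addr0.
- by move=> [v u]; rewrite /sdp_mul /sdp_one /= addNr addNr.
- by move=> [v u]; rewrite /sdp_mul /sdp_one /= mulmxN mulmxA AV mul1mx !subrr.
- move=> p; have c1 : q.1.1 + A q.1.2 *m q.2.1 @[q --> p] --> p.1.1 + A p.1.2 *m p.2.1.
    apply: cvgD; first by apply: (@cvg_comp _ _ _ fst fst); [exact: cvg_fst|exact: cvg_fst].
    apply: cvg_mulmx; last by apply: (@cvg_comp _ _ _ snd fst); [exact: cvg_snd|exact: cvg_fst].
    apply: continuous_cvg; first exact: cA.
    by apply: (@cvg_comp _ _ _ fst snd); [exact: cvg_fst|exact: cvg_snd].
  have c2 : q.1.2 + q.2.2 @[q --> p] --> p.1.2 + p.2.2.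
    apply: cvgD.
      by apply: (@cvg_comp _ _ _ fst snd); [exact: cvg_fst|exact: cvg_snd].
    by apply: (@cvg_comp _ _ _ snd snd); [exact: cvg_snd|exact: cvg_snd].
  exact: (cvg_pair c1 c2).
- move=> p; have c1 : - (A (- q.2) *m q.1) @[q --> p] --> - (A (- p.2) *m p.1).
    apply: cvgN; apply: cvg_mulmx; last exact: cvg_fst.
    apply: continuous_cvg; first exact: cA.
    by apply: cvgN; exact: cvg_snd.
  have c2 : - q.2 @[q --> p] --> - p.2 by apply: cvgN; exact: cvg_snd.
  exact: (cvg_pair c1 c2).
Qed.

End FlowEstimates.

(** * Abelian cocycles *)

Section AbelianCocycles.
Variables (R : realType) (X : pseudoMetricType R) (Tz : int -> X -> X).
Hypothesis me : minimal_equicontinuous Tz.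
Hypothesis lcX : locally_connected X.

Lemma continuous_family_bounded (g : int -> X -> R) (M : nat) :
  (forall j, continuous (g j)) ->
  exists C : R, forall j : int, (`|j| <= M)%N -> forall x, g j x <= C.
Proof.
move=> cg.
have one j : exists C : R, forall x, g j x <= C.
  have [[x1 _]|X0] := pselect (exists x : X, True); last first.
    by exists 0 => x; exfalso; apply: X0; exists x.
  have [||c _ cmax] := @compact_EVT_max X R (g j) setT _ (me_compact me).
  - by exists x1.
  - exact: continuous_subspaceT (cg j).
  by exists (g j c) => x; apply: cmax; rewrite in_setT.
elim: M => [|M [C HC]].
  have [C HC] := one 0; exists C => j j0 x.
  by have -> : j = 0 by lia.
have [C1 HC1] := one M.+1%:Z; have [C2 HC2] := one (- M.+1%:Z).
exists (Num.max C (Num.max C1 C2)) => j jM x; rewrite !le_max.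
have [jM'|jM'] := leqP `|j| M; first by rewrite HC.
have [->|->] : j = M.+1%:Z \/ j = - M.+1%:Z by lia.
  by rewrite HC1 orbT.
by rewrite HC2 !orbT.
Qed.

Lemma additive_topological_group (V : normedModType R) :
  topological_group (fun v w : V => v + w) (fun v => - v) 0.
Proof.
split; [split|exact: add_continuous|exact: opp_continuous].
- exact: addrA.
- exact: add0r.
- exact: addr0.
- exact: addNr.
- exact: subrr.
Qed.

Variables (d : nat) (F : int -> X -> 'cV[R]_d).
Local Notation addV := (fun v w : 'cV[R]_d => v + w).
Hypothesis cc : continuous_cocycle Tz addV F.

Let tgV := additive_topological_group ('cV[R]_d : normedModType R).

Let P_continuous (P : 'M[R]_d) : continuous (fun v : 'cV[R]_d => P *m v).
Proof. by move=> v; apply: (@cvg_mulmx R _ _ _ _ (fun=> P) id (nbhs v) _ P v); [exact: cvg_cst|exact: cvg_id]. Qed.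

Let norm_P_continuous (P : 'M[R]_d) : continuous (fun v : 'cV[R]_d => `|P *m v|).
Proof.
move=> v; apply: (@continuous_comp _ _ _ (fun v : 'cV[R]_d => P *m v) Num.norm).
  exact: P_continuous.
exact: norm_continuous.
Qed.

Lemma closed_fixed (P : 'M[R]_d) : closed [set v : 'cV[R]_d | P *m v = v].
Proof.
have -> : [set v : 'cV[R]_d | P *m v = v] = [set v | `|(P - 1%:M) *m v| <= 0].
  by apply/seteqP; split=> v /=; rewrite mulmxBl mul1mx normr_le0 subr_eq0 => /eqP.
apply: (@closed_comp _ _ (fun v : 'cV[R]_d => `|(P - 1%:M) *m v|) [set z | z <= 0]).
  by move=> v _; exact: norm_P_continuous.
exact: closed_le.
Qed.

Lemma closed_norm_ge (V : normedModType R) (r : R) : closed [set v : V | r <= `|v|].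
Proof.
apply: (@closed_comp _ _ (fun v : V => `|v|) [set z | r <= z]).
  by move=> v _; exact: norm_continuous.
exact: closed_ge.
Qed.

(** Every time is within [M] of a good one, which bounds the cocycle along the orbit of [y]. Values
    elsewhere are limits of differences of two such values, whence the doubled constant. *)
Lemma bounded_of_syndetic (P : 'M[R]_d) (U : set X) (r : R) (M : nat) :
  U !=set0 ->
  (forall k : int, exists n : int,
    (`|k - n| <= M)%N /\ forall y, U y -> `|P *m F n y| <= r) ->
  exists C : R, forall n x, `|P *m F n x| <= C.
Proof.
move=> [y Uy] syn.
have cPF j : continuous (fun x => `|P *m F j x|).
  move=> x; apply: (@continuous_comp _ _ _ (F j) (fun v : 'cV[R]_d => `|P *m v|)).
    exact: (cc_continuous cc).
  exact: norm_P_continuous.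
have [C HC] := continuous_family_bounded M cPF.
have bU k : `|P *m F k y| <= C + r.
  have [n [kn sn]] := syn k.
  rewrite -[k](subrK n) (cc_add cc) mulmxDr (le_trans (ler_normD _ _))// lerD//.
    exact: HC.
  exact: sn.
exists (C + r + (C + r)) => n x; rewrite leNgt; apply/negP => lt.
have [||j /= ltj] := me_dense me y (U := [set z | C + r + (C + r) < `|P *m F n z|]).
- apply: (@open_comp _ _ (fun z => `|P *m F n z|) [set t | C + r + (C + r) < t]).
    by move=> z _; exact: cPF.
  exact: open_gt.
- by exists x.
have FE : F n (Tz j y) = F (n + j) y - F j y by rewrite (cc_add cc) addrK.
move: ltj; rewrite ltNge => /negP; apply; rewrite FE mulmxBr.
by rewrite (le_trans (ler_normB _ _))// lerD.
Qed.

Lemma abelian_cocycle_structure (x1 : X) : recurrent_cocycle Tz (0 : 'cV[R]_d) F ->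
  exists P : 'M[R]_d, [/\ P *m P = P, forall v, P *m v = 0 -> ess Tz F v &
    exists C : R, forall n x, `|P *m F n x| <= C].
Proof.
move=> rec.
have [||||P [PP PL [eps eps0 gapP]]] := @closed_subgroup_projection R d (ess Tz F).
- by have h := orbit_ess_at1 me tgV cc; move=> x; apply: orbit_ess_at_sub.
- by move=> v w; exact: (ess_mul me tgV cc).
- by move=> v; exact: (ess_inv me tgV cc).
- move=> v lim; apply: ess_limit => V /nbhs_distP[e e0 eV].
  by have [w hw vw] := lim e e0; exists w => //; exact: eV.
have PE v : P *m v = 0 -> ess Tz F v by move=> /PL/(_ 1); rewrite scale1r.
exists P; split=> //.
(* [r'] is twice [r], as sums and differences require, and is below the discreteness constant [eps]
   of [ess]. *)
pose r := eps / 4; pose r' := eps / 2.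
have r0 : 0 < r by rewrite divr_gt0.
have rr' : r < r' by rewrite /r /r'; lra.
have [[U [dl0 [oU cU U0 dl00 gap]]]|nogap] := pselect (exists U (dl0 : R),
    [/\ open U, connected U, U !=set0, 0 < dl0 &
     forall n x, U x -> near_id Tz dl0 n -> `|P *m F n x| <= r' -> `|P *m F n x| <= r]).
  have [||||M syn] := @gap_syndetic _ _ _ _ _ _ _ _ me tgV cc
      (fun v => `|P *m v|) U r r' dl0 _ _ r0 rr' _ _ oU cU U0 dl00 gap rec.
  - exact: norm_P_continuous.
  - by rewrite mulmx0 normr0.
  - move=> v w vr wr; rewrite mulmxDr (le_trans (ler_normD _ _))//.
    by rewrite (le_trans (lerD vr wr))// /r /r'; lra.
  - move=> v w vr wr; rewrite mulmxBr (le_trans (ler_normB _ _))//.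
    by rewrite (le_trans (lerD vr wr))// /r /r'; lra.
  exact: bounded_of_syndetic U0 syn.
exfalso.
(* Without a gap, values of size in [(r, r']] modulo the kernel of [P] occur near [x1]. Corrected by
   essential values in that kernel they land in [K], and a limit point is an essential value
   contradicting [gapP]. *)
pose K := [set v : 'cV[R]_d | `|v| <= r'] `&`
  ([set v | r <= `|v|] `&` [set v | P *m v = v]).
have cK : compact K.
  apply: compact_closedI; first exact: compact_ball_cV.
  by apply: closedI; [exact: closed_norm_ge|exact: closed_fixed].
pose Q (e : R) (v : 'cV[R]_d) := exists m z,
  [/\ near_id Tz (e + e) m, ball x1 e z & `|v - F m z| < e].
have [|e e0|u [/= ur' [ru Pu]] uQ] := compact_limit (P := Q) cK.
- move=> e1 e2 e12 v [m [z [nm xz vz]]]; exists m, z; split.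
  + by apply: near_id_le nm; rewrite lerD.
  + exact: le_ball xz.
  + exact: lt_le_trans e12.
- have [U [oU Ux1 cU sU]] := lcX (nbhsx_ballx x1 e e0).
  have [n [y [Uy nn ltr ler]]] : exists n y, [/\ U y, near_id Tz e n,
      r < `|P *m F n y| & `|P *m F n y| <= r'].
    apply: contrapT => nex; apply: nogap; exists U, e; split=> //; first by exists x1.
    move=> n x Ux nn le; rewrite leNgt; apply/negP => lt; apply: nex.
    by exists n, x.
  have hl : ess Tz F (P *m F n y - F n y).
    by apply: PE; rewrite mulmxBr mulmxA PP subrr.
  have Uy' : nbhs y (ball x1 e) by apply: filterS sU _; exact: open_nbhs_nbhs.
  have Vy : nbhs (F n y + (P *m F n y - F n y)) [set w | `|P *m F n y - w| < e].
    by rewrite addrC subrK; exact: nbhs_dist.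
  have [m [z [nm xz vz]]] := ess_at_extend me tgV cc nn Uy' hl Vy e0.
  exists (P *m F n y); last by exists m, z.
  by split=> //; split=> /=; [exact: ltW|rewrite mulmxA PP].
have /(ess_at_abelian me tgV cc) : ess_at Tz F x1 u.
  move=> U V dl /nbhs_ballP[e1 /= e10 sU] /nbhs_distP[e2 e20 sV] dl0.
  pose e := Num.min (Num.min (dl / 2) e1) (e2 / 2).
  have e0 : 0 < e by rewrite !lt_min !divr_gt0//= e10.
  have [v uv [m [z [nm xz vz]]]] := uQ _ e (nbhs_dist u e0) e0.
  exists m, z; split.
  - by apply: near_id_le nm; rewrite [dl]splitr lerD// !ge_min lexx.
  - by apply: sU; apply: le_ball xz; rewrite !ge_min lexx ?orbT.
  - apply: sV; rewrite -(subrK v u) -addrA (le_lt_trans (ler_normD _ _))//.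
    rewrite [e2]splitr ltrD//.
      by apply: lt_le_trans uv _; rewrite !ge_min lexx ?orbT.
    by apply: lt_le_trans vz _; rewrite !ge_min lexx ?orbT.
move=> /(_ (fun g h => addrC g h))/gapP.
rewrite Pu => /(_ _)H; have u0 : u = 0.
  by apply: H; apply: le_lt_trans ur' _; rewrite /r'; lra.
by move: ru; rewrite u0 normr0 leNgt r0.
Qed.

(** Otherwise some nonzero [u] is an essential value, and so are all its integer multiples, while
    essential values of a bounded cocycle are bounded. *)
Lemma bounded_cocycle_small (C : R) : (forall n x, `|F n x| <= C) ->
  forall e : R, 0 < e -> exists2 dl : R, 0 < dl &
    forall n, near_id Tz dl n -> forall x, `|F n x| <= e.
Proof.
move=> FC e e0; apply: contrapT => nex.
pose K := [set: X] `*` ([set v : 'cV[R]_d | `|v| <= C] `&` [set v | e <= `|v|]).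
have cK : compact K.
  apply: compact_setX; first exact: (me_compact me).
  by apply: compact_closedI; [exact: compact_ball_cV|exact: closed_norm_ge].
pose Q (dl : R) (t : X * 'cV[R]_d) := exists2 n, near_id Tz dl n & t.2 = F n t.1.
have [|dl dl0|[x u] [/= _ [uC eu]] uQ] := compact_limit (P := Q) cK.
- by move=> d1 d2 d12 t [n nn tE]; exists n => //; exact: near_id_le nn.
- have [n [nn [x lt]]] : exists n, near_id Tz dl n /\ exists x, e < `|F n x|.
    apply: contrapT => ne; apply: nex; exists dl => // n nn x.
    by rewrite leNgt; apply/negP => lt; apply: ne; exists n; split=> //; exists x.
  exists (x, F n x); last by exists n.
  by split=> //=; split=> //; exact: ltW.
have /(ess_at_abelian me tgV cc) : ess_at Tz F x u.
  move=> U V dl Ux Vu dl0.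
  have [|[y v] [/= Uy Vv] [n nn /= vE]] := uQ (U `*` V) dl _ dl0; first by exists (U, V).
  by exists n, y; split=> //; rewrite -vE.
move=> /(_ (fun g h => addrC g h)) essu.
have bd v : ess Tz F v -> `|v| <= C + 1.
  move=> /(_ x setT [set w | `|v - w| < 1] 1 filterT (nbhs_dist v ltr01) ltr01).
  move=> [n [y [_ _ /= vF]]]; rewrite -(subrK (F n y) v) (le_trans (ler_normD _ _))//.
  by rewrite addrC lerD// ltW.
have u0 : 0 < `|u| by exact: lt_le_trans eu.
have [k kP] : exists k : nat, C + 1 < k%:R * `|u|.
  exists (Num.trunc ((`|C| + 1) / `|u|)).+1; rewrite -ltr_pdivrMr//.
  have /andP[_] := truncn_itv (x := (`|C| + 1) / `|u|) (divr_ge0 (addr_ge0 (normr_ge0 _) ler01) (ltW u0)).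
  by apply: le_lt_trans; rewrite ler_pM2r ?invr_gt0// lerD2r ler_norm.
have /bd : ess Tz F (k%:~R *: u).
  apply: (@subgroup_mulrz R d (ess Tz F)) => //.
  - by move=> y; apply: orbit_ess_at_sub; exact: (orbit_ess_at1 me tgV cc).
  - by move=> v w; exact: (ess_mul me tgV cc).
  - by move=> v; exact: (ess_inv me tgV cc).
by rewrite normrZ normr_nat leNgt kP.
Qed.

End AbelianCocycles.

(** * Real cocycles, viewed as [R^1]-valued ones *)

Section RealCocycles.
Variables (R : realType) (X : pseudoMetricType R) (Tz : int -> X -> X).
Hypothesis me : minimal_equicontinuous Tz.
Hypothesis lcX : locally_connected X.
Variable c : int -> X -> R.
Hypothesis cc : continuous_cocycle Tz (fun s t : R => s + t) c.

Let F (n : int) (x : X) : 'cV[R]_1 := const_mx (c n x).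

Let normF n x : `|F n x| = `|c n x|.
Proof.
apply/eqP; rewrite eq_le; apply/andP; split.
  by apply: mx_norm_le => // i j; rewrite mxE.
by have := entry_le_norm (F n x) ord0 ord0; rewrite mxE.
Qed.

Let ccF : continuous_cocycle Tz (fun v w : 'cV[R]_1 => v + w) F.
Proof.
split=> [n|n m x].
  apply: continuous_mx => i j.
  rewrite (_ : (fun _ => _) = c n); first exact: (cc_continuous cc).
  by apply/funext => x; rewrite mxE.
by rewrite /F (cc_add cc); apply/matrixP => i j; rewrite !mxE.
Qed.

Lemma real_cocycle_dichotomy (x1 : X) : recurrent_cocycle Tz (0 : R) c ->
  (exists C : R, forall n x, `|c n x| <= C) \/
  (forall (x : X) (U : set X) (s dl e : R), nbhs x U -> 0 < dl -> 0 < e ->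
    exists n y, [/\ near_id Tz dl n, U y & `|c n y - s| < e]).
Proof.
move=> rec.
have recF : recurrent_cocycle Tz (0 : 'cV[R]_1) F.
  move=> V U oV V0 oU U0.
  have /nbhs_distP[e e0 eV] : nbhs (0 : 'cV[R]_1) V by exact: open_nbhs_nbhs.
  have [||n [n0 [x [Ux UTx cx]]]] := rec [set t | `|t| < e] U _ _ oU U0.
  - by apply: (@open_comp R R (fun t : R => `|t|) [set t | t < e]) => [t _|]; [exact: norm_continuous|exact: open_lt].
  - by rewrite /= normr0.
  exists n; split=> //; exists x; split=> //; apply: eV.
  by rewrite sub0r normrN normF.
have [P [PP PE [C PC]]] := abelian_cocycle_structure me lcX ccF x1 recF.
have P11 : P = (P ord0 ord0)%:M by rewrite [LHS]mx11_scalar.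
have [p0|p0] := eqVneq (P ord0 ord0) 0.
  right=> x U s dl e Ux dl0 e0.
  have h : P *m (const_mx s : 'cV[R]_1) = 0 by rewrite P11 p0 raddf0 mul0mx.
  have := PE _ h x U [set w | `|const_mx s - w| < e] dl Ux (nbhs_dist _ e0) dl0.
  move=> [n [y [nn Uy /= lt]]]; exists n, y; split=> //.
  rewrite distrC; apply: le_lt_trans lt.
  by have := entry_le_norm (const_mx s - F n y) ord0 ord0; rewrite !mxE.
left; exists (C / `|P ord0 ord0|) => n x.
rewrite ler_pdivlMr ?normr_gt0// mulrC -normF -normrZ -mul_scalar_mx -P11.
exact: PC.
Qed.

(** As in the Gottschalk-Hedlund theorem, the transfer function is the supremum of the cocycle over
    all times. It is continuous because the functions [c n] are equicontinuous. *)
Lemma bounded_real_cocycle_coboundary (C : R) : (forall n x, `|c n x| <= C) ->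
  exists phi : X -> R, continuous phi /\ forall n x, c n x = phi x - phi (Tz n x).
Proof.
move=> cC.
pose S x := [set c n x | n in [set: int]].
pose phi x := sup (S x).
have Sne x : S x !=set0 by exists (c 0 x), 0.
have Sub x : has_ubound (S x).
  by exists C => _ [n _ <-]; exact: le_trans (ler_norm _) (cC n x).
have phi_le n x : c n x <= phi x by apply: ub_le_sup => //; exists n.
have phi_ub x b : (forall n, c n x <= b) -> phi x <= b.
  by move=> cb; apply: ge_sup => // _ [n _ <-].
exists phi; split; last first.
  have le n x : phi (Tz n x) <= phi x - c n x.
    by apply: phi_ub => m; rewrite lerBrDr -(cc_add cc).
  move=> n x; apply/eqP; rewrite eq_sym subr_eq addrC -subr_eq eq_sym eq_le le /=.
  have := le (- n) (Tz n x); rewrite -(me_add me) addNr (me_0 me) => h.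
  have := cc_add cc (- n) n x; rewrite addNr.
  have := cc_add cc 0 0 x; rewrite addr0 (me_0 me) => c0 h2.
  move: h c0 h2; move: (c (- n) (Tz n x)) (c n x) (c 0 x) (phi x) (phi (Tz n x)).
  by move=> *; lra.
move=> x; apply/cvgrPdist_le => e e0.
have FC n y : `|F n y| <= C by rewrite normF.
have [dl dl0 dlP] := bounded_cocycle_small me ccF FC (divr_gt0 e0 (ltr0n R 2)).
have [eta eta0 etaP] := me_near me dl0.
(* Commuting the times gives [c n y - c n (Tz m y) = c m y - c m (Tz n y)], which is small for every
   [n] once [m] is close to the identity. Density of the orbit of [y] extends this to [z]. *)
have close n y z : (ball y eta)° z -> `|c n y - c n z| <= e.
  move=> yz; rewrite leNgt; apply/negP => lt.
  have cn : continuous (fun w => `|c n y - c n w|).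
    move=> w; apply: (@continuous_comp _ _ _ (fun w => c n y - c n w) Num.norm).
      by apply: cvgB; [exact: cvg_cst|exact: (cc_continuous cc)].
    exact: norm_continuous.
  have [||m [/interior_subset ym /= lt']] := me_dense me y
      (U := (ball y eta)° `&` [set w | e < `|c n y - c n w|]).
  - apply: openI; first exact: open_interior.
    by apply: (@open_comp _ _ (fun w => `|c n y - c n w|) [set t | e < t]) => [w _|]; [exact: cn|exact: open_gt].
  - by exists z.
  have nm := etaP _ _ ym.
  have := dlP m nm (Tz n y); have := dlP m nm y; rewrite !normF => b1 b2.
  have : c n (Tz m y) + c m y = c m (Tz n y) + c n y by rewrite -!(cc_add cc) addrC.
  move=> E; move: lt'; rewrite ltNge => /negP; apply.
  have -> : c n y - c n (Tz m y) = c m y - c m (Tz n y).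
    by apply/eqP; rewrite subr_eq addrAC eq_sym subr_eq addrC E addrC.
  by rewrite (le_trans (ler_normB _ _))// [e]splitr lerD.
near=> y.
have xy : (ball x eta)° y.
  near: y; apply: nbhs_interior; exact: nbhsx_ballx.
have lexy : phi x <= phi y + e.
  apply: phi_ub => n; have := close n x y xy; have := phi_le n y.
  rewrite ler_norml; lra.
have leyx : phi y <= phi x + e.
  apply: phi_ub => n; have := close n x y xy; have := phi_le n x.
  rewrite ler_norml; lra.
rewrite ler_norml; lra.
Unshelve. all: by end_near. Qed.

End RealCocycles.

(** * Generic points, from countable bases with rational centres *)

Section GenericPoints.
Variable R : realType.

Lemma rat_dense_cV d (v : 'cV[R]_d) (e : R) : 0 < e ->
  exists q : 'cV[rat]_d, `|map_mx ratr q - v| < e.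
Proof.
move=> e0; have e20 : 0 < e / 2 by rewrite divr_gt0.
have /choice[q qP] : forall i : 'I_d, exists q : rat, `|ratr q - v i ord0| <= e / 2.
  move=> i; have /rat_in_itvoo[q] : v i ord0 < v i ord0 + e / 2 by rewrite ltrDl.
  rewrite in_itv /= => /andP[q1 q2]; exists q.
  by rewrite ger0_norm ?subr_ge0 ?(ltW q1)// lerBlDl ltW.
exists (\col_i q i); apply: (@le_lt_trans _ _ (e / 2)); last first.
  by rewrite ltr_pdivrMr// ltr_pMr// ltrDl.
apply: mx_norm_le => [|i j]; first exact: ltW.
by rewrite !mxE (ord1 j); exact: qP.
Qed.

Lemma rat_dense (s e : R) : 0 < e -> exists q : rat, `|ratr q - s| < e.
Proof.
move=> e0; have /rat_in_itvoo[q] : s < s + e by rewrite ltrDl.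
rewrite in_itv /= => /andP[q1 q2]; exists q.
by rewrite ger0_norm ?subr_ge0 ?(ltW q1)// ltrBlDl.
Qed.

Lemma natSinv_lt (e : R) : 0 < e -> exists k : nat, k.+1%:R^-1 < e.
Proof.
move=> e0; have [k _ /(_ k (leqnn _)) ke] := near_infty_natSinv_lt (PosNum e0).
by exists k.
Qed.

Lemma open_dist (V : normedModType R) (v : V) (e : R) : open [set w | `|v - w| < e].
Proof.
apply: (@open_comp _ _ (fun w : V => `|v - w|) [set t | t < e]); last exact: open_lt.
move=> w _; apply: (@continuous_comp _ _ _ (fun w : V => v - w) Num.norm).
  by apply: cvgB; [exact: cvg_cst|exact: cvg_id].
exact: norm_continuous.
Qed.

Lemma dist_half (V : normedModType R) (a b c : V) (e : R) :
  `|a - b| < e / 2 -> `|a - c| < e / 2 -> `|b - c| < e.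
Proof.
move=> ab ac; rewrite -(subrK a b) -addrA (le_lt_trans (ler_normD _ _))//.
by rewrite distrC [e]splitr ltrD.
Qed.

Variables (X : pseudoMetricType R) (Tz : int -> X -> X).
Hypothesis me : minimal_equicontinuous Tz.

Lemma generic_point_cV d (F : int -> X -> 'cV[R]_d) (x1 : X) :
  continuous_cocycle Tz (fun v w : 'cV[R]_d => v + w) F ->
  exists x0, forall v, ess_at Tz F x0 v -> orbit_ess_at Tz F x0 v.
Proof.
move=> cc.
pose V (i : 'cV[rat]_d * nat) := [set w : 'cV[R]_d | `|map_mx ratr i.1 - w| < i.2.+1%:R^-1].
have [|x0 x0P] := exists_generic_point me cc (V := V) x1.
  by move=> i; exact: open_dist.
exists x0 => v ev W dl /nbhs_distP[e e0 eW] dl0.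
have [k ke] := natSinv_lt (divr_gt0 e0 (ltr0n R 2)).
have k0 : 0 < k.+1%:R^-1 :> R by rewrite invr_gt0.
have [q qv] := rat_dense_cV v k0.
have [|n [nn Vn]] := x0P (q, k) _ dl dl0.
  move=> U dl' Ux dl'0; apply: ev => //.
  by apply: open_nbhs_nbhs; split=> //; exact: open_dist.
exists n; split=> //; apply: eW; apply: (dist_half (a := map_mx ratr q)).
  exact: lt_trans ke.
exact: lt_trans ke.
Qed.

Lemma generic_point_sdp d (A : R -> 'M[R]_d) (F : int -> X -> 'cV[R]_d * R) (x1 : X) :
  continuous_cocycle Tz (sdp_mul A) F ->
  exists x0, (forall g, ess_at Tz F x0 g -> orbit_ess_at Tz F x0 g) /\
    forall s : R, (forall U (dl e : R), nbhs x0 U -> 0 < dl -> 0 < e ->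
        exists n y, [/\ near_id Tz dl n, U y & `|(F n y).2 - s| < e]) ->
      forall dl e : R, 0 < dl -> 0 < e ->
        exists n, near_id Tz dl n /\ `|(F n x0).2 - s| < e.
Proof.
move=> cc.
have oball (s e : R) : open [set g : 'cV[R]_d * R | `|s - g.2| < e].
  apply: (@open_comp _ _ (fun g : 'cV[R]_d * R => g.2) [set t | `|s - t| < e]).
    by move=> g _; exact: cvg_snd.
  exact: (@open_dist R^o).
(* The cylinders [inr] serve the second claim: a limit of the [R]-components need not come from an
   element of [ess_at], as the [R^d]-components may be unbounded. *)
pose V (i : 'cV[rat]_d * rat * nat + rat * nat) := match i with
  | inl i => [set g : 'cV[R]_d * R | `|map_mx ratr i.1.1 - g.1| < i.2.+1%:R^-1] `&`
      [set g | `|ratr i.1.2 - g.2| < i.2.+1%:R^-1]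
  | inr i => [set g | `|ratr i.1 - g.2| < i.2.+1%:R^-1] end.
have oV i : open (V i).
  case: i => [[[q s] k]|[s k]]; last exact: oball.
  apply: openI; last exact: oball.
  apply: (@open_comp _ _ (fun g : 'cV[R]_d * R => g.1) [set t | `|map_mx ratr q - t| < k.+1%:R^-1]).
    by move=> g _; exact: cvg_fst.
  exact: open_dist.
have [x0 x0P] := exists_generic_point me cc x1 oV.
exists x0; split.
  move=> [v u] ev W dl [[W1 W2] [/= /nbhs_distP[e1 e10 eW1]]].
  move=> /(@nbhs_distP R R^o)[e2 e20 eW2] sW dl0.
  pose e := Num.min e1 e2.
  have e0 : 0 < e by rewrite lt_min e10.
  have [k ke] := natSinv_lt (divr_gt0 e0 (ltr0n R 2)).
  have k0 : 0 < k.+1%:R^-1 :> R by rewrite invr_gt0.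
  have [q qv] := rat_dense_cV v k0.
  have [s su] := rat_dense u k0.
  have [|n [nn [/= V1 V2]]] := x0P (inl (q, s, k)) _ dl dl0.
    move=> U dl' Ux dl'0; apply: ev => //.
    by apply: open_nbhs_nbhs; split=> //; exact: (oV (inl (q, s, k))).
  exists n; split=> //; apply: sW; split=> /=.
    apply: eW1; apply: (@lt_le_trans _ _ e); last by rewrite ge_min lexx.
    by apply: (dist_half (a := map_mx ratr q)); exact: lt_trans ke.
  apply: eW2; apply: (@lt_le_trans _ _ e); last by rewrite ge_min lexx orbT.
  by apply: (@dist_half R^o (ratr s)); exact: lt_trans ke.
move=> s sP dl e dl0 e0.
have [k ke] := natSinv_lt (divr_gt0 e0 (ltr0n R 2)).
have k0 : 0 < k.+1%:R^-1 :> R by rewrite invr_gt0.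
have [q qs] := rat_dense s k0.
have [|n [nn /= Vn]] := x0P (inr (q, k)) _ dl dl0.
  move=> U dl' Ux dl'0.
  have [|n [y [nn Uy lt]]] := sP U dl' (k.+1%:R^-1 - `|ratr q - s|) Ux dl'0.
    by rewrite subr_gt0.
  exists n, y; split=> //=.
  rewrite -(subrK s (ratr q)) -addrA (le_lt_trans (ler_normD _ _))//.
  by rewrite -ltrBrDl distrC.
exists n; split=> //; rewrite distrC.
by apply: (@dist_half R^o (ratr q)); exact: lt_trans ke.
Qed.

End GenericPoints.

(** * Cocycles with values in the semidirect product *)

Section SemidirectCocycles.
Variables (R : realType) (X : pseudoMetricType R) (Tz : int -> X -> X).
Hypothesis me : minimal_equicontinuous Tz.
Hypothesis lcX : locally_connected X.
Variables (d : nat) (A : R -> 'M[R]_d).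
Hypothesis cA : continuous A.
Hypothesis A0 : A 0 = 1%:M.
Hypothesis AD : forall s t, A (s + t) = A s *m A t.
Hypothesis eigA : forall u, u != 0 -> ~~ eigenvalue (A u) 1.
Variable F : int -> X -> 'cV[R]_d * R.
Hypothesis cc : continuous_cocycle Tz (sdp_mul A) F.
Hypothesis rec : recurrent_cocycle Tz (sdp_one R d) F.

Let tgG := sdp_topological_group cA A0 AD.
Local Notation c n x := (F n x).2.
Local Notation b n x := (F n x).1.

Definition onto_orbit_closure (x0 : X) :=
  fst @` closure [set (Tz n x0, sdp_mul A (F n x0) (sdp_one R d)) | n in [set: int]]
  = [set: X].

Lemma cocycle_snd : continuous_cocycle Tz (fun s t : R => s + t) (fun n x => c n x).
Proof.
split=> [n x|n m x]; last by rewrite (cc_add cc).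
by apply: (@continuous_comp _ _ _ (F n) snd); [exact: (cc_continuous cc)|exact: cvg_snd].
Qed.

Lemma recurrent_snd : recurrent_cocycle Tz (0 : R) (fun n x => c n x).
Proof.
move=> V U oV V0 oU U0; apply: (rec (V := snd @^-1` V)) => //.
by apply: open_comp => // g _; exact: cvg_snd.
Qed.

Lemma continuous_norm_bounded (g : X -> R) : continuous g ->
  exists2 M : R, 0 <= M & forall x, `|g x| <= M.
Proof.
move=> cg.
have [M MP] : exists M : R, forall j : int, (`|j| <= 0)%N -> forall x, `|g x| <= M.
  apply: (@continuous_family_bounded _ _ _ me (fun=> fun x => `|g x|) 0) => _ x.
  by apply: (@continuous_comp _ _ _ g Num.norm); [exact: cg|exact: norm_continuous].
exists `|M| => // x; exact: le_trans (MP 0 isT x) (ler_norm _).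
Qed.

(* Twisting by the transfer function [phi] turns [F] into an [R^d]-valued cocycle. *)
Lemma regular_of_coboundary (phi : X -> R) (x1 : X) : continuous phi ->
  (forall n x, c n x = phi x - phi (Tz n x)) -> exists x0, onto_orbit_closure x0.
Proof.
move=> cphi cE.
pose B n x := A (phi (Tz n x)) *m b n x.
have [M M0 phiM] := continuous_norm_bounded cphi.
have [k k1 kP] := flow_bounded cA M0.
have k0 : 0 < k by exact: lt_le_trans k1.
have ccB : continuous_cocycle Tz (fun v w : 'cV[R]_d => v + w) B.
  split=> [n x|n m x].
    apply: cvg_mulmx; last first.
      by apply: (@continuous_comp _ _ _ (F n) fst); [exact: (cc_continuous cc)|exact: cvg_fst].
    apply: (@continuous_comp _ _ _ (fun x => phi (Tz n x)) A); last exact: cA.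
    by apply: (@continuous_comp _ _ _ (Tz n) phi); [exact: (me_continuous me)|exact: cphi].
  rewrite /B (cc_add cc) /= mulmxDr mulmxA -AD cE -!(me_add me); congr (_ + A _ *m _).
  by rewrite addrC subrK.
have recB : recurrent_cocycle Tz (0 : 'cV[R]_d) B.
  move=> V U oV V0 oU U0.
  have /nbhs_distP[e e0 eV] : nbhs (0 : 'cV[R]_d) V by exact: open_nbhs_nbhs.
  have q0 : 0 < e / (d%:R * k + 1) by rewrite divr_gt0// ltr_wpDl// mulr_ge0// ltW.
  have [||n [n0 [x [Ux UTx /= bx]]]] := rec (V := fst @^-1` [set v | `|0 - v| < e / (d%:R * k + 1)]) _ _ oU U0.
  - by apply: open_comp => [g _|]; [exact: cvg_fst|exact: open_dist].
  - by rewrite /= subrr normr0.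
  exists n; split=> //; exists x; split=> //; apply: eV.
  rewrite sub0r normrN; apply: le_lt_trans (norm_mulmx_le _ _) _.
  apply: (@le_lt_trans _ _ ((d%:R * k + 1) * `|b n x|)).
    rewrite ler_wpM2r//; apply: (@le_trans _ _ (d%:R * k)); last by rewrite lerDl.
    by rewrite ler_wpM2l// kP.
  move: bx; rewrite sub0r normrN ltr_pdivlMr 1?mulrC// ltr_wpDl// mulr_ge0// ltW//.
have [P [PP PE [C PC]]] := abelian_cocycle_structure me lcX ccB x1 recB.
have [x0 x0P] := generic_point_cV me x1 ccB.
have tgV := additive_topological_group ('cV[R]_d : normedModType R).
exists x0.
apply: (orbit_closure_onto me tgG cc (U0 := setT)
    (K := [set g | `|g.1| <= d%:R * k * (C + 1) /\ `|g.2| <= M + M])).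
- exact: compact_ball_cVR.
- exact: openT.
- by exists x0.
move=> U oU U0 _; have [j UT] := me_dense me x0 oU U0.
(* Adding this essential value replaces [B j x0] by its bounded projection, up to an error 1 for the
   actual time [m]. *)
have hl : orbit_ess_at Tz B x0 (P *m B j x0 - B j x0).
  by apply: x0P; apply: PE; rewrite mulmxBr mulmxA PP subrr.
have Vj : nbhs (B j x0 + (P *m B j x0 - B j x0)) [set w | `|P *m B j x0 - w| < 1].
  by rewrite addrC subrK; exact: nbhs_dist.
have Uj : nbhs (Tz j x0) U by exact: open_nbhs_nbhs.
have [m [Um /= Bm]] := orbit_ess_at_extend me tgV ccB hl Uj Vj.
exists m, (sdp_one R d); split=> //; first exact: (orbit_ess_at1 me tgG cc).
rewrite /= mulmx0 !addr0; split.
  have -> : b m x0 = A (- phi (Tz m x0)) *m B m x0.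
    by rewrite /B mulmxA -AD addNr A0 mul1mx.
  apply: le_trans (norm_mulmx_le _ _) _.
  apply: ler_pM; rewrite ?mulr_ge0//; first by rewrite ler_wpM2l// kP// normrN.
  rewrite -(subrK (P *m B j x0) (B m x0)) addrC (le_trans (ler_normD _ _))//.
  by rewrite lerD// distrC ltW.
by rewrite cE (le_trans (ler_normB _ _))// lerD.
Qed.

(** * The case where the [R]-component approximates every real number along near-identity times *)

Section Ergodic.
Variable x0 : X.
Hypothesis generic : forall g, ess_at Tz F x0 g -> orbit_ess_at Tz F x0 g.
Hypothesis dense_snd : forall s dl e : R, 0 < dl -> 0 < e ->
  exists n, near_id Tz dl n /\ `|c n x0 - s| < e.

Local Notation D := (ess_at Tz F x0).
Local Notation E := (ess Tz F).

Let D_mul g h : D g -> D h -> D (sdp_mul A g h).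
Proof.
move=> /generic Dg /generic Dh; apply: orbit_ess_at_sub.
exact: (orbit_ess_at_mul me tgG cc).
Qed.

Let AV u : A u *m A (- u) = 1%:M. Proof. by rewrite -AD subrr A0. Qed.

Let cvgA (w : 'cV[R]_d) (s : R) : A t *m w @[t --> s] --> A s *m w.
Proof. by apply: cvg_mulmx; [exact: cA|exact: cvg_cst]. Qed.

(** Conjugating [(w, 0)] by [F n x0] gives [(A (c n x0) w, 0)] at [Tz n x0]. By [dense_snd],
    [Tz n x0] can be steered close to [y] with [c n x0] close to [s] simultaneously. *)
Lemma ess_translation (w : 'cV[R]_d) s : D (w, 0) -> E (A s *m w, 0).
Proof.
move=> Dw y; apply: ess_at_limit => U V Uy [[V1 V2] [/= V1s V20] sV].
have /(@nbhs_distP R R^o)[e e0 eV] := cvgA V1s.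
have [||j UT] := me_dense me x0 (U := U°); [exact: open_interior|by exists y|].
have e20 : 0 < e / 2 by rewrite divr_gt0.
have nU : nbhs x0 (Tz j @^-1` U) by apply: (me_continuous me).
have nc : nbhs x0 [set z | `|c j x0 - c j z| < e / 2].
  exact: (cc_continuous cocycle_snd (@nbhs_dist R R^o (c j x0) _ e20)).
have [dl dl0 dlP] := near_id_into Tz (filterI nU nc).
have [n [nn cn]] := dense_snd (s - c j x0) dl0 e20.
have [UTn cjn] := dlP n nn.
exists (Tz (j + n) x0), (A (c (j + n) x0) *m w, 0); split.
- by rewrite (me_add me).
- apply: sV; split=> /=; last exact: nbhs_singleton.
  apply: eV; rewrite (cc_add cc) /=.
  have -> : s - (c j (Tz n x0) + c n x0) = (c j x0 - c j (Tz n x0)) - (c n x0 - (s - c j x0)).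
    by ring.
  by rewrite [e]splitr (le_lt_trans (ler_normB _ _))// ltrD.
- have := @ess_at_conj _ _ _ _ _ _ _ _ me tgG cc x0 (w, 0) (j + n) Dw.
  rewrite /sdp_mul /sdp_inv /= !addr0 subrr mulmxN mulmxA AV mul1mx.
  by rewrite addrAC subrr add0r.
Qed.

Lemma translation_projection :
  exists P : 'M[R]_d, P *m P = P /\ forall w, E (w, 0) <-> P *m w = 0.
Proof.
apply: (@flow_invariant_subgroup _ _ A cA A0 eigA [set w | E (w, 0)]).
- by move=> y; apply: orbit_ess_at_sub; exact: (orbit_ess_at1 me tgG cc).
- move=> v w Ev Ew; have := ess_mul me tgG cc Ev Ew.
  by rewrite /sdp_mul /= A0 mul1mx addr0.
- move=> v Ev; have := ess_inv me tgG cc Ev.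
  by rewrite /sdp_inv /= oppr0 A0 mul1mx.
- move=> v lim; apply: ess_limit => V [[V1 V2] [/= /nbhs_distP[e e0 eV] V20] sV].
  have [w Ew vw] := lim e e0; exists (w, 0) => //.
  by apply: sV; split=> /=; [exact: eV|exact: nbhs_singleton].
- by move=> s v Ev; apply: ess_translation.
Qed.

Section Projection.
Variable P : 'M[R]_d.
Hypothesis PP : P *m P = P.
Hypothesis PE : forall w, E (w, 0) <-> P *m w = 0.

Let PA u : P *m A u = P *m A u *m P.
Proof.
apply: stable_kernelE => // v /PE Ev; apply/PE.
by apply: ess_translation.
Qed.

Let PAker u (v : 'cV[R]_d) : P *m v = 0 -> P *m (A u *m v) = 0.
Proof. by move=> Pv; rewrite mulmxA PA -mulmxA Pv mulmx0. Qed.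

Lemma ess_at_modulo y (v w : 'cV[R]_d) s : P *m v = P *m w ->
  ess_at Tz F y (v, s) -> ess_at Tz F y (w, s).
Proof.
move=> Pvw yv; have Ew : E (A (- s) *m (w - v), 0).
  by apply/PE; apply: PAker; rewrite mulmxBr Pvw subrr.
have := ess_at_mul me tgG cc yv Ew.
by rewrite /sdp_mul /= mulmxA AV mul1mx addr0 addrC subrK.
Qed.

Let sg (g : 'cV[R]_d * R) : R := `|g.2| + `|P *m g.1|.

Let sg_continuous : continuous sg.
Proof.
move=> g; apply: cvgD; apply: cvg_norm; first exact: cvg_snd.
by apply: (@cvg_mulmx R _ _ _ _ (fun=> P) fst (nbhs g) _ P g.1); [exact: cvg_cst|exact: cvg_fst].
Qed.

(** A gap would make the times of small size syndetic and bound [c] along the orbit of [x0], against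
    [dense_snd]. The factor [1 + k * k] reflects that [g h^-1] applies the flow twice to the
    translation part of [h]. *)
Lemma no_gap (r k : R) : 0 < r -> r <= 1 -> 1 <= k ->
  (forall u (v : 'cV[R]_d), `|u| <= 1 -> `|P *m (A u *m v)| <= k * `|P *m v|) ->
  exists g, [/\ D g, P *m g.1 = g.1, r <= sg g & sg g <= (1 + k * k) * r].
Proof.
move=> r0 r1 k1 kP.
set r' := (1 + k * k) * r.
have kr : r <= k * r by rewrite ler_peMl// ltW.
have kkr : k * r <= k * k * r.
  by rewrite -mulrA ler_peMl// mulr_ge0 ?ltW// (lt_le_trans ltr01).
have rr' : r < r' by rewrite /r' mulrDl mul1r ltrDl; lra.
have sg_le g : sg g <= r -> `|g.2| <= 1 /\ (`|g.2| <= r /\ `|P *m g.1| <= r).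
  rewrite /sg => gr; have := normr_ge0 g.2; have := normr_ge0 (P *m g.1); lra.
have [[U [dl0 [oU cU U0 dl00 gap]]]|nogap] := pselect (exists U (dl0 : R),
    [/\ open U, connected U, U !=set0, 0 < dl0 &
     forall n x, U x -> near_id Tz dl0 n -> sg (F n x) <= r' -> sg (F n x) <= r]).
  exfalso.
  have [|||M syn] := @gap_syndetic _ _ _ _ _ _ _ _ me tgG cc
      sg U r r' dl0 sg_continuous _ r0 rr' _ _ oU cU U0 dl00 gap rec.
  - by rewrite /sg /= mulmx0 !normr0 addr0.
  - move=> g h gr hr; have [g1 _] := sg_le g gr.
    apply: (@le_trans _ _ (sg g + k * r)); last by rewrite /r' mulrDl mul1r lerD.
    have hk : k * `|h.2| + k * `|P *m h.1| <= k * r.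
      by rewrite -mulrDr ler_wpM2l// (le_trans ler01).
    have h2k : `|h.2| <= k * `|h.2| by rewrite ler_peMl.
    have := kP g.2 h.1 g1; have := ler_normD g.2 h.2.
    have := ler_normD (P *m g.1) (P *m (A g.2 *m h.1)).
    rewrite /sg /= mulmxDr; lra.
  - move=> g h gr hr; have [g1 _] := sg_le g gr; have [h0 _] := sg_le h hr.
    have k0 : 0 <= k by exact: le_trans k1.
    have k2 : 0 <= k * k by rewrite mulr_ge0.
    apply: (@le_trans _ _ (sg g + k * k * r)); last by rewrite /r' mulrDl mul1r lerD.
    have h0' : `|- h.2| <= 1 by rewrite normrN.
    have := kP g.2 (- (A (- h.2) *m h.1)) g1.
    rewrite !mulmxN !normrN => H1.
    have := ler_wpM2l k0 (kP (- h.2) h.1 h0') => H2.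
    rewrite /sg /= mulmxDr !mulmxN.
    have := ler_normB g.2 h.2.
    have := ler_normB (P *m g.1) (P *m (A g.2 *m (A (- h.2) *m h.1))).
    have := ler_wpM2l k2 hr; rewrite /sg mulrDr.
    have : `|h.2| <= k * k * `|h.2|.
      by rewrite ler_peMl// -[1]mulr1 ler_pM.
    move: H1 H2; rewrite !mulrA; lra.
  have [C HC] : exists C : R, forall j : int, (`|j| <= M)%N -> forall x, `|c j x| <= C.
    apply: (@continuous_family_bounded _ _ _ me (fun j x => `|c j x|) M) => j x.
    by apply: (@cvg_norm R R^o); exact: (cc_continuous cocycle_snd).
  have [j UT] := me_dense me x0 oU U0.
  (* The target exceeds what a syndetic time [m] at distance at most [M] from [n - j] allows for
     [c n x0]. *)
  have [n [_ cn]] := dense_snd (C + r + `|c j x0| + 1) ltr01 ltr01.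
  have [m [nm sm]] := syn (n - j).
  have cnE : c n x0 = c (n - j - m) (Tz m (Tz j x0)) + c m (Tz j x0) + c j x0.
    have := cc_add cocycle_snd (n - j) j x0; rewrite subrK => ->.
    by have := cc_add cocycle_snd (n - j - m) m (Tz j x0); rewrite subrK => ->.
  have [_ [cm _]] := sg_le _ (sm _ UT).
  have := HC _ nm (Tz m (Tz j x0)); have := ler_norm (c j x0).
  move: cn cm; rewrite cnE ltr_norml !ler_norml; lra.
pose K := [set g : 'cV[R]_d * R | `|g.1| <= r' /\ `|g.2| <= r'] `&`
  ([set g | r <= sg g] `&` ([set g | sg g <= r'] `&` [set g | P *m g.1 = g.1])).
have cK : compact K.
  apply: compact_closedI; first exact: compact_ball_cVR.
  apply: closedI; last apply: closedI.
  - apply: (@closed_comp _ _ sg [set z | r <= z]); last exact: closed_ge.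
    by move=> g _; exact: sg_continuous.
  - apply: (@closed_comp _ _ sg [set z | z <= r']); last exact: closed_le.
    by move=> g _; exact: sg_continuous.
  - apply: (@closed_comp _ _ fst [set v : 'cV[R]_d | P *m v = v]); last exact: closed_fixed.
    by move=> g _; exact: cvg_fst.
pose Q (e : R) (g : 'cV[R]_d * R) := forall V, nbhs g V -> exists m z,
  [/\ near_id Tz (e + e) m, ball x0 e z & V (F m z)].
have [|e e0|g [/= _ [rg [gr' Pg]]] gQ] := compact_limit (P := Q) cK.
- move=> e1 e2 e12 g gV V Vg; have [m [z [nm xz vz]]] := gV V Vg.
  exists m, z; split=> //; first by apply: near_id_le nm; rewrite lerD.
  exact: le_ball xz.
- have [U [oU Ux1 cU sU]] := lcX (nbhsx_ballx x0 e e0).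
  have [n [y [Uy nn ltr ler]]] : exists n y, [/\ U y, near_id Tz e n,
      r < sg (F n y) & sg (F n y) <= r'].
    apply: contrapT => nex; apply: nogap; exists U, e; split=> //; first by exists x0.
    move=> n x Ux nn le; rewrite leNgt; apply/negP => lt; apply: nex.
    by exists n, x.
  have Uy' : nbhs y (ball x0 e) by apply: filterS sU _; exact: open_nbhs_nbhs.
  have PF : P *m (P *m b n y - b n y) = 0 by rewrite mulmxBr mulmxA PP subrr.
  have hl : E (A (- c n y) *m (P *m b n y - b n y), 0).
    by apply/PE; exact: PAker.
  have sgE : sg (P *m b n y, c n y) = sg (F n y) by rewrite /sg /= mulmxA PP.
  exists (P *m b n y, c n y).
    split=> /=; last by split; [rewrite sgE ltW|split; [rewrite sgE|rewrite mulmxA PP]].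
    move: ler; rewrite /sg; have := normr_ge0 (c n y); have := normr_ge0 (P *m b n y); lra.
  move=> V Vg; apply: (ess_at_extend me tgG cc nn Uy' hl) => //.
  by rewrite /sdp_mul /= mulmxA AV mul1mx addrC subrK addr0.
exists g; split=> //.
move=> U V dl /nbhs_ballP[e1 /= e10 sU] /nbhs_interior Vg dl0.
pose e := Num.min (dl / 2) e1.
have e0 : 0 < e by rewrite lt_min divr_gt0.
have [h Vh hQ] := gQ _ e Vg e0.
have [m [z [nm xz vz]]] := hQ V Vh.
exists m, z; split=> //.
  by apply: near_id_le nm; rewrite [dl]splitr lerD// ge_min lexx.
by apply: sU; apply: le_ball xz; rewrite ge_min lexx orbT.
Qed.

Let translation0 w : D (w, 0) -> P *m w = 0.
Proof. by move=> Dw; have /PE := @ess_translation w 0 Dw; rewrite A0 mul1mx. Qed.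

(* Elements of [D] off the translation subgroup have a fixed point [p] in [R^d]. *)
Lemma small_hyperbolic_element (e : R) : 0 < e -> exists (p : 'cV[R]_d) u,
  [/\ 0 < u, u <= e, `|P *m ((1%:M - A u) *m p)| <= e & D ((1%:M - A u) *m p, u)].
Proof.
wlog e1 : e / e <= 1.
  move=> wl e0; have [||p [u [u0 ue Pe Dp]]] := wl (Num.min e 1).
  - by rewrite ge_min lexx orbT.
  - by rewrite lt_min e0 ltr01.
  exists p, u; split=> //.
    by apply: le_trans ue _; rewrite ge_min lexx.
  by apply: le_trans Pe _; rewrite ge_min lexx.
move=> e0; have [k k1 kP] := flow_projection_bounded cA PA.
have k0 : 0 < k by exact: lt_le_trans k1.
have q0 : 0 < k * (1 + k * k) by rewrite mulr_gt0// ltr_wpDr// mulr_ge0// ltW.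
(* The extra factor [k] pays for passing to the inverse when [u] is negative. *)
pose r := Num.min 1 (e / (k * (1 + k * k))).
have r0 : 0 < r by rewrite lt_min ltr01 divr_gt0.
have r1 : r <= 1 by rewrite ge_min lexx.
have re : k * ((1 + k * k) * r) <= e.
  by rewrite mulrA mulrC -ler_pdivlMr// ge_min lexx orbT.
have [[v u] [Dg /= Pv rg gr]] := no_gap r0 r1 k1 kP.
have ge : sg (v, u) <= e.
  apply: le_trans gr _; apply: le_trans re; rewrite ler_peMl// mulr_ge0// ?(ltW r0)//.
  by rewrite addr_ge0// mulr_ge0// ltW.
have u0 : u != 0.
  apply/eqP => u0; move: Dg rg; rewrite u0 => /translation0; rewrite Pv => ->.
  by rewrite /sg /= mulmx0 !normr0 addr0 leNgt r0.
have nu : `|u| <= e by apply: le_trans ge; rewrite /sg lerDl.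
have [up|um] := ltP 0 u.
  have vE : (1%:M - A u) *m (invmx (1%:M - A u) *m v) = v.
    by rewrite mulKVmx// flow_sub1_unit.
  exists (invmx (1%:M - A u) *m v), u; rewrite vE; split=> //.
    exact: le_trans (ler_norm _) nu.
  by apply: le_trans ge; rewrite /sg lerDr.
have um' : 0 < - u by rewrite oppr_gt0 lt_neqAle u0.
set v' := - (A (- u) *m v).
have vE : (1%:M - A (- u)) *m (invmx (1%:M - A (- u)) *m v') = v'.
  by rewrite mulKVmx// flow_sub1_unit// oppr_eq0.
exists (invmx (1%:M - A (- u)) *m v'), (- u); rewrite vE; split=> //.
- by apply: le_trans nu; rewrite -normrN ler_norm.
- rewrite /v' mulmxN normrN; apply: le_trans re.
  apply: le_trans (kP _ _ _) _; first by rewrite normrN (le_trans nu).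
  rewrite ler_wpM2l ?(ltW k0)//; apply: le_trans gr.
  by rewrite /sg lerDr.
- exact: (ess_at_inv me tgG cc Dg).
Qed.

(** Otherwise, letting [eta] tend to 0, a limit would be a translation [(w, 0)] in [D] with [w]
    nonzero and fixed by [P], whereas translations in [D] are killed by [P]. *)
Lemma no_escape : exists2 eta : R, 0 < eta & forall y h,
  ball x0 eta y -> ess_at Tz F y h -> `|h.2| <= eta ->
  1 <= `|P *m h.1| -> `|P *m h.1| <= 2 -> False.
Proof.
apply: contrapT => nex.
pose K := [set g : 'cV[R]_d * R | `|g.1| <= 2 /\ `|g.2| <= 1] `&`
  ([set g | 1 <= `|g.1|] `&` [set g | P *m g.1 = g.1]).
have cK : compact K.
  apply: compact_closedI; first exact: compact_ball_cVR.
  apply: closedI.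
    apply: (@closed_comp _ _ fst [set v : 'cV[R]_d | 1 <= `|v|]); last exact: closed_norm_ge.
    by move=> g _; exact: cvg_fst.
  apply: (@closed_comp _ _ fst [set v : 'cV[R]_d | P *m v = v]); last exact: closed_fixed.
  by move=> g _; exact: cvg_fst.
pose Q (e : R) (g : 'cV[R]_d * R) := `|g.2| <= e /\
  exists2 y, ball x0 e y & ess_at Tz F y g.
have [|e e0|[w t] [/= _ [w1 Pw]] wQ] := compact_limit (P := Q) cK.
- move=> e1 e2 e12 g [ge [y xy yg]]; split; first exact: le_trans e12.
  by exists y => //; exact: le_ball xy.
- apply: contrapT => ne; apply: nex; exists (Num.min e 1).
    by rewrite lt_min e0 ltr01.
  move=> y [v u] xy yh /=; rewrite le_min => /andP[ue u1] v1 v2; apply: ne.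
  exists (P *m v, u); first by do !split=> //=; rewrite mulmxA PP.
  split=> //; exists y.
    by apply: le_ball xy; rewrite ge_min lexx.
  by apply: ess_at_modulo yh; rewrite mulmxA PP.
have t0 : t = 0.
  apply/eqP; rewrite -normr_le0; apply/ler_addgt0Pl => e e0; rewrite addr0.
  have e20 : 0 < e / 2 by rewrite divr_gt0.
  have [|[v u] /= tu [/= ue _]] := wQ [set g | `|t - g.2| < e / 2] (e / 2) _ e20.
    exact: (@cvg_snd _ _ (nbhs w) (nbhs t) _ _ (@nbhs_dist R R^o t _ e20)).
  rewrite -(subrK u t) [e]splitr (le_trans (ler_normD _ _))// lerD// ltW//.
have : D (w, 0).
  apply: ess_at_limit => U V /nbhs_ballP[e /= e0 eU] Vw.
  rewrite -t0 in Vw; have [h Vh [_ [y xy yh]]] := wQ V e Vw e0.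
  by exists y, h; split=> //; exact: eU.
move=> /translation0; rewrite Pw => w0; move: w1.
by rewrite w0 normr0 ler10.
Qed.

Lemma hyperbolic_powers (p : 'cV[R]_d) u n : D ((1%:M - A u) *m p, u) ->
  D ((1%:M - A (n%:R * u)) *m p, n%:R * u).
Proof.
move=> Dp; elim: n => [|n IH].
  rewrite mul0r A0 subrr mul0mx; apply: orbit_ess_at_sub.
  exact: (orbit_ess_at1 me tgG cc).
have := D_mul IH Dp; rewrite /sdp_mul /= -natr1 mulrDl mul1r.
by rewrite mulmxA -mulmxDl mulmxBr mulmx1 -AD addrA subrK.
Qed.

(** If [p] were far away, [flow_escape] would provide a power forbidden by [no_escape]. Points [y]
    near [x0] are allowed, since the bound is applied later at the points [Tz n x0]. *)
Lemma fixed_point_bounded : exists eta M : R, 0 < eta /\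
  exists2 tau : R, 0 < tau & forall y (p : 'cV[R]_d) u, ball x0 eta y ->
    0 < u -> u <= tau -> `|P *m ((1%:M - A u) *m p)| <= tau ->
    (forall n : nat, ess_at Tz F y ((1%:M - A (n%:R * u)) *m p, n%:R * u)) ->
    `|P *m p| <= M.
Proof.
have [eta eta0 etaP] := no_escape.
have [M [tau [tau0 MP]]] := flow_escape cA A0 AD eigA PP PA eta0.
exists eta, M; split=> //; exists tau => // y p u xy u0 ut pt yp.
rewrite leNgt; apply/negP => Mp.
have [n [nu n1 n2]] := MP p u (ltW Mp) u0 ut pt.
apply: (etaP y _ xy (yp n)) => //=.
by rewrite ger0_norm// mulr_ge0// ltW.
Qed.

(** Elements with [u] tending to 0 have fixed points bounded modulo the kernel of [P]; their
    projections accumulate at some [p], and the multiples [n u] approximate any [s >= 0]. Inverses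
    give the negative [s]. *)
Lemma exists_fixed_point : exists p : 'cV[R]_d, forall s, D ((1%:M - A s) *m p, s).
Proof.
have [eta [M [eta0 [tau tau0 MP]]]] := fixed_point_bounded.
pose Q (e : R) (p : 'cV[R]_d) := exists u, [/\ 0 < u, u <= e &
  forall n : nat, D ((1%:M - A (n%:R * u)) *m p, n%:R * u)].
have [|e e0|p _ pQ] := compact_limit (P := Q) (@compact_ball_cV R d M).
- move=> e1 e2 e12 p [u [u0 ue Dp]]; exists u; split=> //; exact: le_trans e12.
- have m0 : 0 < Num.min e tau by rewrite lt_min e0.
  have [p [u [u0 ue Pe Dp]]] := small_hyperbolic_element m0.
  move: ue Pe; rewrite !le_min => /andP[ue ut] /andP[_ pt].
  have Dn n := @hyperbolic_powers p u n Dp.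
  exists (P *m p); first by apply: (MP x0 p u) => //; exact: ballxx.
  exists u; split=> // n; apply: ess_at_modulo (Dn n).
  by rewrite !mulmxBl !mul1mx !mulmxBr !mulmxA PP -PA.
exists p; have pos s : 0 <= s -> D ((1%:M - A s) *m p, s).
  move=> s0; apply: ess_at_limit => U V Ux [[V1 V2] [/= V1s V2s] sV].
  have c1 : (1%:M - A t.1) *m t.2 @[t --> (s, p)] --> (1%:M - A s) *m p.
    apply: cvg_mulmx; last exact: cvg_snd.
    apply: cvgB; first exact: cvg_cst.
    by apply: continuous_cvg; [exact: cA|exact: cvg_fst].
  have [[W1 W2] [/= /(@nbhs_distP R R^o)[e1 e10 eW1] W2p] sW] := c1 _ V1s.
  have /(@nbhs_distP R R^o)[e2 e20 eV2] := V2s.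
  pose e := Num.min e1 e2 / 2.
  have e0 : 0 < e by rewrite divr_gt0// lt_min e10.
  have [q W2q [u [u0 ue Dq]]] := pQ W2 e W2p e0.
  have := truncn_itv (x := s / u) (divr_ge0 s0 (ltW u0)).
  set n := Num.trunc _ => /andP[n1 n2].
  have sn : `|s - n%:R * u| < Num.min e1 e2.
    move: n1 n2; rewrite ler_pdivlMr// ltr_pdivrMr// -natr1 mulrDl mul1r => n1 n2.
    have me0 : 0 < Num.min e1 e2 by rewrite lt_min e10.
    rewrite ger0_norm ?subr_ge0//; move: ue; rewrite /e; lra.
  move: sn; rewrite lt_min => /andP[sn1 sn2].
  exists x0, ((1%:M - A (n%:R * u)) *m q, n%:R * u); split=> //.
    exact: nbhs_singleton.
  apply: sV; split=> /=; last exact: eV2.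
  by apply: (sW (n%:R * u, q)); split=> //=; exact: eW1.
move=> s; have [s0|s0] := leP 0 s; first exact: pos.
have /pos/(ess_at_inv me tgG cc) : 0 <= - s by rewrite oppr_ge0 ltW.
rewrite /sdp_inv /= opprK mulmxA mulmxBr mulmx1 AV -mulNmx opprB.
by [].
Qed.

Lemma ergodic_onto : onto_orbit_closure x0.
Proof.
have [p pD] := exists_fixed_point.
have [eta [M [eta0 [tau tau0 MP]]]] := fixed_point_bounded.
(* The image of [p] under the affine map [F n x0]. Conjugation turns the elements fixing [p] into
   elements of [ess_at] at [Tz n x0] fixing [q n], so [fixed_point_bounded] applies to [q n]. *)
pose q n := b n x0 + A (c n x0) *m p.
have qD n s : ess_at Tz F (Tz n x0) ((1%:M - A s) *m q n, s).
  have := @ess_at_conj _ _ _ _ _ _ _ _ me tgG cc x0 _ n (pD s).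
  have -> // : sdp_mul A (sdp_mul A (F n x0) ((1%:M - A s) *m p, s)) (sdp_inv A (F n x0))
      = ((1%:M - A s) *m q n, s).
  rewrite /sdp_mul /sdp_inv /=; congr (_, _); last by rewrite addrAC subrr add0r.
  rewrite mulmxN (mulmxA (A (c n x0 + s))) -AD [c n x0 + s]addrC addrK /q mulmxDr.
  rewrite addrAC [in RHS]mulmxBl mul1mx; congr (_ + _).
  rewrite !mulmxA; congr (_ *m p).
  by rewrite mulmxBr mulmxBl mulmx1 mul1mx -!AD [s + _]addrC.
have qM n : ball x0 eta (Tz n x0) -> `|P *m q n| <= M.
  move=> xn.
  have c1 : P *m ((1%:M - A u) *m q n) @[u --> (0 : R)] --> P *m ((1%:M - A 0) *m q n).
    apply: cvg_mulmx; first exact: cvg_cst.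
    apply: cvg_mulmx; last exact: cvg_cst.
    by apply: cvgB; [exact: cvg_cst|exact: cA].
  have /(@nbhs_distP R R^o)[e e0 eP] := c1 _ (nbhs_dist _ tau0).
  pose u := Num.min (e / 2) tau.
  have u0 : 0 < u by rewrite lt_min divr_gt0.
  apply: (MP (Tz n x0) (q n) u) => //; first by rewrite ge_min lexx orbT.
  have := eP u; rewrite /= A0 subrr mul0mx mulmx0 !sub0r !normrN => /(_ _)/ltW; apply.
  rewrite gtr0_norm// (@le_lt_trans _ _ (e / 2)) ?ge_min ?lexx//.
  by rewrite ltr_pdivrMr// ltr_pMr// ltrDl.
apply: (orbit_closure_onto me tgG cc (U0 := (ball x0 eta)°)
    (K := [set g | `|g.1| <= M + `|p| /\ `|g.2| <= 0])).
- exact: compact_ball_cVR.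
- exact: open_interior.
- by exists x0; exact: nbhsx_ballx.
move=> U oU U0 UB; have [n UT] := me_dense me x0 oU U0.
have /interior_subset/qM qn := UB _ UT.
(* The first factor fixes [p] and cancels the [R]-component, leaving [(q n - p, 0)]; the second is a
   translation in the kernel of [P], leaving [(P q n - p, 0)]. *)
exists n, (sdp_mul A ((1%:M - A (- c n x0)) *m p, - c n x0) (P *m q n - q n, 0)).
split=> //.
  apply: generic; apply: (ess_at_mul me tgG cc (pD _)).
  by apply/PE; rewrite mulmxBr mulmxA PP subrr.
rewrite /sdp_mul /= addr0 subrr normr0; split=> //.
have -> : b n x0 + A (c n x0) *m ((1%:M - A (- c n x0)) *m p +
    A (- c n x0) *m (P *m q n - q n)) = P *m q n - p.
  rewrite mulmxDr !mulmxA mulmxBr mulmx1 AV mul1mx mulmxBl mul1mx addrA.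
  by rewrite [b n x0 + _]addrA -/(q n) addrC addrA subrK.
by rewrite (le_trans (ler_normB _ _))// lerD.
Qed.

End Projection.
End Ergodic.

Lemma semidirect_onto (x1 : X) : exists x0, onto_orbit_closure x0.
Proof.
have [[C cC]|erg] := real_cocycle_dichotomy me lcX cocycle_snd x1 recurrent_snd.
  have [phi [cphi phiE]] := bounded_real_cocycle_coboundary me cocycle_snd cC.
  exact: regular_of_coboundary x1 cphi phiE.
have [x0 [gen den]] := generic_point_sdp me x1 cc.
have dense_snd (s dl e : R) : 0 < dl -> 0 < e ->
    exists n, near_id Tz dl n /\ `|c n x0 - s| < e.
  by apply: den => U dl' e'; exact: (erg x0 U s).
have [P [PP PE]] := translation_projection dense_snd.
by exists x0; exact: (ergodic_onto gen dense_snd PP PE).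
Qed.

End SemidirectCocycles.

(** * Rotations *)

Lemma int_step_ind (Q : int -> Prop) : Q 0 -> (forall n, Q n -> Q (n + 1)) ->
  (forall n, Q n -> Q (n - 1)) -> forall n, Q n.
Proof.
move=> Q0 QS QP; elim/int_ind => // n Qn; first by rewrite -addn1 PoszD; exact: QS.
by rewrite -addn1 PoszD opprD; exact: QP.
Qed.

Section Rotations.
Variables (R : realType) (X : pseudoMetricType R).
Variables (mul : X -> X -> X) (inv : X -> X) (e a : X).
Hypothesis tg : topological_group mul inv e.

Let gX : is_group mul inv e. Proof. by case: tg. Qed.
Let mulA x y z : mul x (mul y z) = mul (mul x y) z. Proof. by case: gX. Qed.
Let mul1 x : mul e x = x. Proof. by case: gX. Qed.
Let mulx1 x : mul x e = x. Proof. by case: gX. Qed.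
Let mulV x : mul (inv x) x = e. Proof. by case: gX. Qed.
Let mulxV x : mul x (inv x) = e. Proof. by case: gX. Qed.

Lemma gpowzS n : gpowz mul inv e a (n + 1) = mul a (gpowz mul inv e a n).
Proof.
pose pw k := iter k (mul a) e.
have pwC k : mul (pw k) a = mul a (pw k).
  elim: k => [|k IH]; first by rewrite /= mul1 mulx1.
  by rewrite /= -mulA IH.
have pwV k : mul a (inv (pw k.+1)) = inv (pw k).
  have h : mul (mul a (inv (pw k.+1))) (pw k) = e.
    rewrite -[RHS](mulxV a) -mulA; congr (mul _ _).
    have E : mul (mul (inv (pw k.+1)) (pw k)) a = e by rewrite -mulA pwC mulV.
    by rewrite -[LHS]mulx1 -(mulxV a) mulA E mul1.
  by rewrite -[LHS]mulx1 -(mulxV (pw k)) mulA h mul1.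
case: n => [k|[|k]].
- by rewrite /= addn1.
- have -> : Negz 0 + 1 = 0 :> int by [].
  rewrite -[RHS]/(mul a (inv (pw 1%N))) pwV.
  by rewrite /= -[RHS]mulx1 mulV.
- have -> : Negz k.+1 + 1 = Negz k :> int by rewrite !NegzE; lia.
  by rewrite -[RHS]/(mul a (inv (pw k.+2))) pwV.
Qed.

Local Notation Tz := (rotZ mul inv e a).

Lemma rotZ0 x : Tz 0 x = x.
Proof. by rewrite /rotZ /= mul1. Qed.

Lemma rotZD n m x : Tz (n + m) x = Tz n (Tz m x).
Proof.
rewrite /rotZ mulA; congr (mul _ x).
elim/int_step_ind: n m => [m|n IH m|n IH m].
- by rewrite add0r /= mul1.
- by rewrite addrAC !gpowzS IH mulA.
- have step k : gpowz mul inv e a (k - 1) = mul (inv a) (gpowz mul inv e a k).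
    by rewrite -[in RHS](subrK 1 k) gpowzS mulA mulV mul1.
  by rewrite addrAC !step IH mulA.
Qed.

(** For [me_near], compactness is used twice: elements close to the identity move all points by
    little, and [z y^-1] is close to the identity uniformly for [z] close to [y]. With [z] equal to
    [Tz n y], this quotient is the power of [a] itself. *)
Lemma rotation_minimal_equicontinuous : compact [set: X] ->
  minimal_rotation mul inv e a -> minimal_equicontinuous Tz.
Proof.
move=> cX mr; have [_ cM cI] := tg.
split.
- exact: cX.
- exact: rotZ0.
- exact: rotZD.
- move=> n x B /(cM (gpowz mul inv e a n, x))[[B1 B2] [/= B1g B2x] sB].
  apply: filterS B2x => y B2y.
  by apply: (sB (_, y)); split=> //; exact: nbhs_singleton.
- move=> x U oU [u Uu].
  have : closure [set Tz n x | n in [set: int]] u by rewrite mr.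
  by move=> /(_ U (open_nbhs_nbhs (conj oU Uu)))[_ [[n _ <-] Un]]; exists n.
move=> dl dl0; have d20 : 0 < dl / 2 by rewrite divr_gt0.
have /compact_near_coveringP cov := cX.
have [V Ve VP] : exists2 V : set X, nbhs e V & forall g, V g -> forall x, ball x dl (mul g x).
  have := cov X (nbhs e) (fun g x => ball x dl (mul g x)) _ _.
  move=> h; exists [set g | setT `<=` (fun x => ball x dl (mul g x))]; last by move=> g + x; apply.
  apply: h => x _.
  have /(cM (e, x))[[B1 B2] [/= B1e B2x] sB] : nbhs (mul e x) (ball x (dl / 2)).
    by rewrite mul1; exact: nbhsx_ballx.
  exists (B2 `&` ball x (dl / 2), B1).
    by split=> //=; apply: filterI => //; exact: nbhsx_ballx.
  move=> [y g] /= [[B2y xy] B1g]; apply: (@ball_split _ _ x); first exact: ball_sym.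
  exact: (sB (g, y)).
have [eta [eta0 etaP]] : exists eta : R, 0 < eta /\
    forall y z, ball y eta z -> V (mul z (inv y)).
  have h := cov R (at_right 0) (fun eta y => forall z, ball y eta z -> V (mul z (inv y))) _ _.
  have : \forall eta \near at_right (0 : R),
      [set: X] `<=` (fun y => forall z, ball y eta z -> V (mul z (inv y))).
    apply: h => x _.
    have : nbhs (mul x (inv x)) V by rewrite mulxV.
    move=> /(cM (x, inv x))[[B1 B2] [/= B1x /cI B2x] sB].
    move: B1x => /nbhs_ballP[r /= r0 rB].
    have r20 : 0 < r / 2 by rewrite divr_gt0.
    exists ((inv @^-1` B2) `&` ball x (r / 2), [set eta : R | eta < r / 2]).
      split=> /=; last exact: nbhs_right_lt.
      by apply: filterI => //; exact: nbhsx_ballx.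
    move=> [y eta] /= [[B2y xy] er] z yz; apply: (sB (z, inv y)); split=> //=.
    apply: rB; apply: (@ball_split _ _ y) => //.
    by apply: le_ball yz; exact: ltW.
  move=> ev; have [eta [eta0 H]] := filter_ex (filterI (nbhs_right_gt (0 : R)) ev).
  by exists eta; split=> // y z; apply: H.
exists eta => // n x xn; apply: VP.
by have := etaP _ _ xn; rewrite /rotZ -mulA mulxV mulx1.
Qed.

End Rotations.

(** * The cocycle generated by a continuous function *)

Section CocycleIdentity.
Variables (R : realType) (X : pseudoMetricType R) (Tz : int -> X -> X).
Variables (G : topologicalType) (mul : G -> G -> G) (inv : G -> G) (e : G).
Variable f : X -> G.
Hypothesis me : minimal_equicontinuous Tz.
Hypothesis tgG : topological_group mul inv e.
Hypothesis cf : continuous f.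

Let gG : is_group mul inv e. Proof. by case: tgG. Qed.
Let mulA x y z : mul x (mul y z) = mul (mul x y) z. Proof. by case: gG. Qed.
Let mul1 x : mul e x = x. Proof. by case: gG. Qed.
Let mulx1 x : mul x e = x. Proof. by case: gG. Qed.
Let mulV x : mul (inv x) x = e. Proof. by case: gG. Qed.
Let mulxV x : mul x (inv x) = e. Proof. by case: gG. Qed.

Local Notation F := (cocycle mul inv e Tz f).

(** Splits off the factor at the starting point instead of the last one, as needed for negative
    times, which are read from a shifted base point. *)
Lemma cocycle_nat_shift k x :
  cocycle_nat mul e Tz f k.+1 x = mul (cocycle_nat mul e Tz f k (Tz 1 x)) (f x).
Proof.
elim: k => [|k IH]; first by rewrite /= (me_0 me) mul1 mulx1.
rewrite [LHS]/= -[mul (f (Tz k x)) _]/(cocycle_nat mul e Tz f k.+1 x) IH mulA.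
by rewrite /= -(me_add me) -PoszD addn1.
Qed.

Lemma cocycleS n x : F (n + 1) x = mul (f (Tz n x)) (F n x).
Proof.
case: n => [k|k]; first by rewrite /= addn1.
have E : mul (f (Tz (Negz k) x)) (inv (cocycle_nat mul e Tz f k.+1 (Tz (Negz k) x)))
    = inv (cocycle_nat mul e Tz f k (Tz (- k%:Z) x)).
  set y := Tz (Negz k) x.
  have -> : Tz (- k%:Z) x = Tz 1 y.
    by rewrite /y -(me_add me); congr (Tz _ x); rewrite NegzE; lia.
  rewrite cocycle_nat_shift; set g := cocycle_nat _ _ _ _ _ _.
  have h : mul (mul (f y) (inv (mul g (f y)))) g = e.
    rewrite -[RHS](mulxV (f y)) -mulA; congr (mul _ _).
    by rewrite -[LHS]mulx1 -(mulxV (f y)) mulA -[mul (mul _ g) _]mulA mulV mul1.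
  by rewrite -[LHS]mulx1 -(mulxV g) mulA h mul1.
rewrite [in RHS]/cocycle E; case: k {E} => [|k].
  have -> : Negz 0 + 1 = 0 :> int by [].
  by rewrite /= -[RHS]mulx1 mulV.
have -> : Negz k.+1 + 1 = Negz k :> int by rewrite !NegzE; lia.
by rewrite /cocycle NegzE.
Qed.

Lemma cocycle_continuous_cocycle : continuous_cocycle Tz mul F.
Proof.
have FP n x : F (n - 1) x = mul (inv (f (Tz (n - 1) x))) (F n x).
  by have := cocycleS (n - 1) x; rewrite subrK => ->; rewrite mulA mulV mul1.
have [_ cM cI] := tgG.
have cmul (g h : X -> G) : continuous g -> continuous h -> continuous (fun x => mul (g x) (h x)).
  move=> cg ch x; apply: (@continuous2_cvg _ _ _ _ _ _ g h mul); [|exact: cg|exact: ch].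
  exact: (cM (g x, h x)).
have cfT n : continuous (fun x => f (Tz n x)).
  by move=> x; apply: continuous_comp; [exact: (me_continuous me)|exact: cf].
split.
  elim/int_step_ind => [|n IH|n IH].
  - by move=> x; exact: cvg_cst.
  - by rewrite (_ : F (n + 1) = fun x => mul (f (Tz n x)) (F n x));
      [exact: cmul|apply/funext => x; exact: cocycleS].
  - rewrite (_ : F (n - 1) = fun x => mul (inv (f (Tz (n - 1) x))) (F n x));
      last by apply/funext => x; exact: FP.
    apply: cmul => // x; apply: (@continuous_comp _ _ _ (fun x => f (Tz (n - 1) x)) inv).
      exact: cfT.
    exact: cI.
elim/int_step_ind => [m x|n IH m x|n IH m x].
- by rewrite add0r /= mul1.
- by rewrite addrAC !cocycleS IH (me_add me) mulA.
- by rewrite addrAC !FP IH addrAC (me_add me) mulA.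
Qed.

End CocycleIdentity.

Theorem theorem5p1 (R : realType) (X : metricType R)
  (mulX : X -> X -> X) (invX : X -> X) (eX : X) (a : X)
  (d : nat) (A : R -> 'M[R]_d) (f : X -> 'cV[R]_d * R) :
  topological_group mulX invX eX ->
  compact [set: X] ->
  locally_connected X ->
  minimal_rotation mulX invX eX a ->
  continuous A ->
  A 0 = 1%:M ->
  (forall u1 u2, A (u1 + u2) = A u1 *m A u2) ->
  (forall u, A u \in unitmx) ->
  (forall u, u != 0 -> ~~ eigenvalue (A u) 1) ->
  continuous f ->
  recurrent (sdp_mul A) (sdp_inv A) (sdp_one R d) (rotZ mulX invX eX a) f ->
  regular (sdp_mul A) (sdp_inv A) (sdp_one R d) (rotZ mulX invX eX a) f.
Proof.
move=> tgX cX lcX mr cA A0 AD _ eigA cf rec.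
have me := rotation_minimal_equicontinuous tgX cX mr.
have cc := cocycle_continuous_cocycle me (sdp_topological_group cA A0 AD) cf.
have [x0 onto] := semidirect_onto me lcX cA A0 AD eigA cc rec eX.
by exists x0, (sdp_one R d).
Qed.
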